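(* Assume that $Z$ is consistent. In $Z$ the statement $SD$ is strictly weaker than $AC_{\aleph_0}$; that is, $Z + AC_{\aleph_0} \vdash SD$, while there exists a model $\mathcal{M}$ of $Z$ in which $SD$ holds but $AC_{\aleph_0}$ fails.
   Context: The system $Z$ is the first-order theory with equality and one binary predicate $\in$ (all objects are sets, no atoms), with the axioms: Extensionality; Null Set (existence of $\emptyset$); Pair Set; Union Set; Infinity (there is an inductive set: a set containing $\emptyset$ and closed under $a \mapsto a \cup \{a\}$); Power Set; and the axiom schema of restricted Comprehension (for every set $a$ and every formula $\varphi(x,u_1,\dots,u_n)$ with parameters $u_i$, the set $\{x \in a : \varphi(x,u_1,\dots,u_n)\}$ exists). The axioms of Replacement, Foundation and Choice are not included in $Z$. $AC_{\aleph_0}$ (Axiom of Countable Choice): for every set $b$ and every binary relation $P \subseteq \omega \times b$, if for all $n \in \omega$ there is $y \in b$ with $P(n,y)$, then there is $f : \omega \to b$ with $P(n,f(n))$ for all $n \in \omega$. Here $\omega$ is the least inductive set; its elements are the natural numbers, and $n = \{0,\dots,n-1\}$. Two sets are equipotent if there is a bijection between them. A set is finite if it is equipotent to some $n \in \omega$. A set is Standard Infinite if it is not finite. A set $X$ is Dedekind Infinite if it contains a proper subset $B \subset X$ equipotent to $X$. $SD$ is the statement: if a set is Standard Infinite, then it is also Dedekind Infinite. $T \vdash \psi$ means that $\psi$ is provable from $T$. *)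

(* Defs.v *)
From Stdlib Require Import List.
Import ListNotations.

(** * First-order logic with equality and one binary predicate

    Variables are de Bruijn indices; as the language has no function symbols,
    they are the only terms and substitutions are renamings. *)

Inductive form : Type :=
| Bot : form
| Eq  : nat -> nat -> form
| Mem : nat -> nat -> form
| Imp : form -> form -> form
| All : form -> form.

Definition Neg (A : form) : form := Imp A Bot.
Definition And (A B : form) : form := Neg (Imp A (Neg B)).
Definition Or  (A B : form) : form := Imp (Neg A) B.
Definition Iff (A B : form) : form := And (Imp A B) (Imp B A).
Definition Ex  (A : form) : form := Neg (All (Neg A)).

Declare Scope form_scope.
Delimit Scope form_scope with form.
Bind Scope form_scope with form.

Notation "x ≈ y" := (Eq x y) (at level 70, no associativity) : form_scope.
Notation "x ∈ y" := (Mem x y) (at level 70, no associativity) : form_scope.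
Notation "¬ A" := (Neg A) (at level 75, right associativity) : form_scope.
Notation "A ∧ B" := (And A B) (at level 80, right associativity) : form_scope.
Notation "A ∨ B" := (Or A B) (at level 85, right associativity) : form_scope.
Notation "A ⟶ B" := (Imp A B) (at level 90, right associativity) : form_scope.
Notation "A ⟷ B" := (Iff A B) (at level 95, no associativity) : form_scope.
Notation "∀ A" := (All A) (at level 75, right associativity) : form_scope.
Notation "∃ A" := (Ex A) (at level 75, right associativity) : form_scope.

Definition scons {X : Type} (x : X) (f : nat -> X) (n : nat) : X :=
  match n with 0 => x | S k => f k end.

Fixpoint rename (r : nat -> nat) (A : form) : form :=
  match A with
  | Bot => Bot
  | Eq x y => Eq (r x) (r y)
  | Mem x y => Mem (r x) (r y)
  | Imp B C => Imp (rename r B) (rename r C)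
  | All B => All (rename (scons 0 (fun n => S (r n))) B)
  end.

Definition inst (x : nat) (A : form) : form := rename (scons x (fun n => n)) A.

(** All free variables of [A] are below [n]. *)
Fixpoint bounded (n : nat) (A : form) : Prop :=
  match A with
  | Bot => True
  | Eq x y | Mem x y => x < n /\ y < n
  | Imp B C => bounded n B /\ bounded n C
  | All B => bounded (S n) B
  end.

(** ** Provability: classical natural deduction *)

Inductive deriv : list form -> form -> Prop :=
| D_hyp  G A : In A G -> deriv G A
| D_impI G A B : deriv (A :: G) B -> deriv G (Imp A B)
| D_impE G A B : deriv G (Imp A B) -> deriv G A -> deriv G B
| D_raa  G A : deriv (Neg A :: G) Bot -> deriv G A
| D_allI G A : deriv (map (rename S) G) A -> deriv G (All A)
| D_allE G A x : deriv G (All A) -> deriv G (inst x A)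
| D_eqI  G x : deriv G (Eq x x)
| D_eqE  G A x y : deriv G (Eq x y) -> deriv G (inst x A) -> deriv G (inst y A).

Definition theory : Type := form -> Prop.

Definition provable (T : theory) (A : form) : Prop :=
  exists G : list form, (forall B, In B G -> T B) /\ deriv G A.

Definition consistent (T : theory) : Prop := ~ provable T Bot.

Definition extend (T : theory) (A : form) : theory := fun B => T B \/ B = A.

(** ** Structures and satisfaction (equality is interpreted as equality) *)

Record structure : Type := {
  carrier :> Type;
  mem : carrier -> carrier -> Prop;
  carrier_nonempty : inhabited carrier
}.

Fixpoint sat (M : structure) (e : nat -> M) (A : form) : Prop :=
  match A with
  | Bot => False
  | Eq x y => e x = e y
  | Mem x y => mem M (e x) (e y)
  | Imp B C => sat M e B -> sat M e C
  | All B => forall a : M, sat M (scons a e) B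
  end.

Definition holds (M : structure) (A : form) : Prop :=
  forall e : nat -> M, sat M e A.

Definition model (M : structure) (T : theory) : Prop :=
  forall A, T A -> holds M A.

(** * The language of set theory

    The arguments of the following formulas are variables; a variable [x] is
    written [k + x] below [k] quantifiers. *)

Local Open Scope form_scope.

Definition is_empty (a : nat) : form := ∀ ¬ 0 ∈ 1+a.

Definition subset (a b : nat) : form := ∀ (0 ∈ 1+a ⟶ 0 ∈ 1+b).

(** [p = {a, b}] *)
Definition is_pair (p a b : nat) : form := ∀ (0 ∈ 1+p ⟷ 0 ≈ 1+a ∨ 0 ≈ 1+b).

(** [u] is the union of the elements of [a] *)
Definition is_union (u a : nat) : form :=
  ∀ (0 ∈ 1+u ⟷ ∃ (0 ∈ 2+a ∧ 1 ∈ 0)).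

Definition is_power (p a : nat) : form := ∀ (0 ∈ 1+p ⟷ subset 0 (1+a)).

(** [s = a ∪ {a}] *)
Definition is_succ (s a : nat) : form := ∀ (0 ∈ 1+s ⟷ 0 ∈ 1+a ∨ 0 ≈ 1+a).

Definition inductive_set (w : nat) : form :=
  ∃ (is_empty 0 ∧ 0 ∈ 1+w) ∧
  ∀ (0 ∈ 1+w ⟶ ∃ (is_succ 0 1 ∧ 0 ∈ 2+w)).

Definition is_omega (w : nat) : form :=
  inductive_set w ∧ ∀ (inductive_set 0 ⟶ subset (1+w) 0).

(** Kuratowski pair: [p = {{a}, {a, b}}] *)
Definition is_opair (p a b : nat) : form :=
  ∃ ∃ (is_pair 1 (2+a) (2+a) ∧ is_pair 0 (2+a) (2+b) ∧ is_pair (2+p) 1 0).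

(** [(a, b) ∈ r] *)
Definition related (r a b : nat) : form :=
  ∃ (is_opair 0 (1+a) (1+b) ∧ 0 ∈ 1+r).

(** [r ⊆ a × b] *)
Definition is_relation (r a b : nat) : form :=
  ∀ (0 ∈ 1+r ⟶ ∃ ∃ (1 ∈ 3+a ∧ 0 ∈ 3+b ∧ is_opair 2 1 0)).

(** [f : a → b]: every [x ∈ a] has exactly one image *)
Definition is_function (f a b : nat) : form :=
  is_relation f a b ∧
  ∀ (0 ∈ 1+a ⟶
     ∃ (related (2+f) 1 0 ∧ ∀ (related (3+f) 2 0 ⟶ 0 ≈ 1))).

(** and every [y ∈ b] has exactly one preimage *)
Definition is_bijection (f a b : nat) : form :=
  is_function f a b ∧
  ∀ (0 ∈ 1+b ⟶
     ∃ (related (2+f) 0 1 ∧ ∀ (related (3+f) 0 2 ⟶ 0 ≈ 1))).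

Definition equipotent (a b : nat) : form := ∃ is_bijection 0 (1+a) (1+b).

Definition is_finite (a : nat) : form :=
  ∃ ∃ (is_omega 1 ∧ 0 ∈ 1 ∧ equipotent (2+a) 0).

Definition standard_infinite (a : nat) : form := ¬ is_finite a.

Definition dedekind_infinite (a : nat) : form :=
  ∃ (subset 0 (1+a) ∧ ¬ 0 ≈ 1+a ∧ equipotent 0 (1+a)).

(** * The theory Z *)

Definition ax_extensionality : form :=
  ∀ ∀ (∀ (0 ∈ 1 ⟷ 0 ∈ 2) ⟶ 0 ≈ 1).
Definition ax_null : form := ∃ is_empty 0.
Definition ax_pair : form := ∀ ∀ ∃ is_pair 0 1 2.
Definition ax_union : form := ∀ ∃ is_union 0 1.
Definition ax_infinity : form := ∃ inductive_set 0.
Definition ax_power : form := ∀ ∃ is_power 0 1.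

(** [A] has the free variables [x = 0] and [u_i = i] for [1 <= i <= n]; below
    the quantifiers on [a], [b] and [x] they become [0] and [i + 2]. *)
Definition ax_comprehension (n : nat) (A : form) : form :=
  Nat.iter n All
    (∀ ∃ ∀ (0 ∈ 1 ⟷ 0 ∈ 2 ∧ rename (scons 0 (fun i => 3 + i)) A)).

Inductive theory_Z : theory :=
| Z_extensionality : theory_Z ax_extensionality
| Z_null : theory_Z ax_null
| Z_pair : theory_Z ax_pair
| Z_union : theory_Z ax_union
| Z_infinity : theory_Z ax_infinity
| Z_power : theory_Z ax_power
| Z_comprehension n A : bounded (S n) A -> theory_Z (ax_comprehension n A).

(** * Countable choice, and "Standard Infinite implies Dedekind Infinite" *)

(** For [w] (= [ω]), [b] and [r], in this order. *)
Definition AC_aleph0 : form :=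
  ∀ ∀ ∀ (is_omega 2 ⟶
         is_relation 0 2 1 ⟶
         ∀ (0 ∈ 3 ⟶ ∃ (0 ∈ 3 ∧ related 2 1 0)) ⟶
         ∃ (is_function 0 3 2 ∧
            ∀ (0 ∈ 4 ⟶ ∃ (related 2 1 0 ∧ related 3 1 0)))).

Definition SD : form := ∀ (standard_infinite 0 ⟶ dedekind_infinite 0).

(* Main.v *)
From Stdlib Require Import List Lia Arith Cantor Qcanon Classical
  ClassicalEpsilon FunctionalExtensionality PropExtensionality ProofIrrelevance.
Require Import Defs.
Import ListNotations.

(** The two halves are proved by unrelated means.

    Provability of [SD] from [Z] and countable choice is reduced by Gödel's
    [completeness] theorem to an argument inside an arbitrary model of [Z],
    whose ω may be non-standard.  If [X] is infinite, every number [n] injects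
    into [X] ([infinite_large]), and countable choice picks one injection
    [f_n] for each [n].  Removing one element from a set into which all numbers
    inject leaves such a set ([large_remove]), so finitely many of the ranges
    never cover all the others, and infinitely many indices [n] contribute an
    element outside the ranges of the earlier [f_m].  Sending the first new
    element of one contributing index to that of the next contributing index,
    and everything else to itself, is an injection of [X] into itself that
    misses a point; no sequence has to be defined by recursion.

    The model in which countable choice fails is a Fraenkel-Mostowski
    permutation model.  Since [Z] lacks Foundation, the atoms can be sets
    [a = {a}].  They are pairs [(n, q)] of a level [n] and a rational [q], and
    the group of all sequences of rationals acts on them by translating each
    level separately.  A set belongs to the model when it and all its hereditary
    members are fixed by the translations that vanish on the first [n] levels, for
    some [n] of their own; such an [n] is called a support.  The relation sending
    [n] to all atoms of level [n] has no choice function: if [n] supported one, a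
    translation of level [n] alone would move its value at [n]
    ([PM_not_choice]).

    [SD] holds in this model because the group is abelian and divisible.  Being
    abelian, it preserves supports: all sets in the orbit of [x] are supported by
    whatever supports [x].  Being divisible, it has no finite orbits other
    than fixed points ([orbit_infinite]).  Hence an infinite set [X] supported by
    [n] has infinitely many members with a common support: either all its
    members are supported by [n], or it contains the infinite orbit of some
    member under the translations that vanish on the first [n] levels.  An
    injective sequence of members with a common support is a set of the model, and
    shifting along it shows that [X] is Dedekind infinite ([PM_SD]). *)

Local Open Scope nat_scope.

(** * Quotients by classes *)

Section Quotient.

Context {X : Type} (R : X -> X -> Prop).

Definition quotient : Type := {C : X -> Prop | exists x, C = R x}.

Definition class_of (x : X) : quotient := exist _ (R x) (ex_intro _ x eq_refl).

Lemma class_of_surj (c : quotient) : exists x, c = class_of x.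
Proof.
  destruct c as [C [x ->]]. now exists x.
Qed.

Lemma class_of_eq (Rrefl : forall x, R x x)
    (Rsym : forall x y, R x y -> R y x)
    (Rtrans : forall x y z, R x y -> R y z -> R x z) x y :
  class_of x = class_of y <-> R x y.
Proof.
  split.
  - intros H. apply (f_equal (@proj1_sig _ _)) in H. simpl in H.
    rewrite H. apply Rrefl.
  - intros H. apply eq_sig_hprop; [intros; apply proof_irrelevance|]. simpl.
    apply functional_extensionality; intros z.
    apply propositional_extensionality. split; eauto.
Qed.

End Quotient.

(** * Renaming and derivability *)

Definition up (r : nat -> nat) : nat -> nat := scons 0 (fun n => S (r n)).

Lemma bounded_mono A : forall m n, m <= n -> bounded m A -> bounded n A.
Proof.
  induction A as [|x y|x y|A1 IHA1 A2 IHA2|A IHA]; simpl; intros m n Hmn H;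
    try lia; intuition eauto.
  apply (IHA (S m)); [lia | assumption].
Qed.

Lemma bounded_exists A : exists n, bounded n A.
Proof.
  induction A as [|x y|x y|A [m HA] B [n HB]|A [n HA]]; simpl.
  - now exists 0.
  - exists (S (x + y)); lia.
  - exists (S (x + y)); lia.
  - exists (m + n). split; eapply bounded_mono; try eassumption; lia.
  - exists n. eapply bounded_mono; try eassumption; lia.
Qed.

Lemma bounded_rename A : forall m n r,
  (forall i, i < m -> r i < n) -> bounded m A -> bounded n (rename r A).
Proof.
  induction A as [|x y|x y|A1 IHA1 A2 IHA2|A IHA]; simpl; intros m p r Hr H; intuition eauto.
  apply (IHA (S m)); [|assumption].
  intros [|i] Hi; simpl; [lia|]. specialize (Hr i). lia.
Qed.

Lemma rename_ext_bounded A : forall m r s,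
  (forall i, i < m -> r i = s i) -> bounded m A -> rename r A = rename s A.
Proof.
  induction A as [|x y|x y|A1 IHA1 A2 IHA2|A IHA]; simpl; intros m r s Hr H; auto.
  - now rewrite !Hr.
  - now rewrite !Hr.
  - destruct H. now rewrite (IHA1 m r s), (IHA2 m r s).
  - f_equal. apply (IHA (S m)); [|assumption].
    intros [|i] Hi; simpl; [reflexivity|]. rewrite Hr; [reflexivity | lia].
Qed.

Lemma rename_ext A r s : (forall i, r i = s i) -> rename r A = rename s A.
Proof.
  intros H. destruct (bounded_exists A) as [n Hn].
  eapply rename_ext_bounded; eauto.
Qed.

Lemma rename_id A : rename (fun i => i) A = A.
Proof.
  induction A as [|x y|x y|A1 IHA1 A2 IHA2|A IHA]; simpl; f_equal; auto.
  rewrite <- IHA at 2. apply rename_ext. now intros [|i].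
Qed.

Lemma rename_closed A r : bounded 0 A -> rename r A = A.
Proof.
  intros H. rewrite <- (rename_id A) at 2.
  apply (rename_ext_bounded A 0); [lia | assumption].
Qed.

Lemma rename_comp A : forall r s,
  rename r (rename s A) = rename (fun i => r (s i)) A.
Proof.
  induction A as [|x y|x y|A1 IHA1 A2 IHA2|A IHA]; simpl; intros r s; f_equal; auto.
  rewrite IHA. apply rename_ext. now intros [|i].
Qed.

Lemma rename_inst A r x : rename r (inst x A) = inst (r x) (rename (up r) A).
Proof.
  unfold inst. rewrite !rename_comp. apply rename_ext. now intros [|i].
Qed.

Lemma deriv_weaken G A : deriv G A -> forall G', incl G G' -> deriv G' A.
Proof.
  induction 1; intros G' HG.
  - now apply D_hyp, HG.
  - apply D_impI, IHderiv. intros C [->|HC]; [now left | right; auto].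
  - eapply D_impE; eauto.
  - apply D_raa, IHderiv. intros C [->|HC]; [now left | right; auto].
  - apply D_allI, IHderiv. now apply incl_map.
  - apply D_allE; auto.
  - apply D_eqI.
  - eapply D_eqE; eauto.
Qed.

Lemma deriv_rename G A : deriv G A ->
  forall r, deriv (map (rename r) G) (rename r A).
Proof.
  induction 1; intros r; simpl in *.
  - now apply D_hyp, in_map.
  - apply D_impI, IHderiv.
  - eapply D_impE; eauto.
  - apply D_raa, IHderiv.
  - apply D_allI. specialize (IHderiv (up r)).
    rewrite map_map in *. erewrite map_ext; [exact IHderiv|].
    intros C. simpl. rewrite !rename_comp. now apply rename_ext.
  - rewrite rename_inst. apply D_allE, IHderiv.
  - apply D_eqI.
  - specialize (IHderiv2 r). rewrite rename_inst in *.
    exact (D_eqE _ _ _ _ (IHderiv1 r) IHderiv2).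
Qed.

(** The rule for the universal quantifier shifts all free variables; renaming the
    fresh variable [y] to 0 and every other variable [n] to [n + 1] turns a
    derivation about [y] into a premise of that rule. *)
Lemma deriv_generalize G B y :
  (forall C, In C G -> bounded y C) -> bounded (S y) B ->
  deriv G (inst y B) -> deriv G (All B).
Proof.
  intros HG HB H. apply D_allI.
  (* below the bound [y] this is the shift [S], so it acts on [G] as the rule does *)
  set (r := fun n => if Nat.eq_dec n y then 0 else S n).
  assert (Hr : forall n, n < y -> r n = S n).
  { intros n Hn. unfold r. destruct (Nat.eq_dec n y); [lia | reflexivity]. }
  apply deriv_rename with (r := r) in H.
  replace (rename r (inst y B)) with B in H.
  - erewrite map_ext_in; [exact H|]. intros C HC.
    symmetry. eapply rename_ext_bounded; eauto.
  - unfold inst. rewrite rename_comp, <- (rename_id B) at 1.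
    eapply rename_ext_bounded; [|exact HB]. intros [|i] Hi; simpl.
    + unfold r. now destruct (Nat.eq_dec y y).
    + symmetry. apply Hr. lia.
Qed.

Lemma provable_hyp (T : theory) A : T A -> provable T A.
Proof.
  intros H. exists [A]. split; [now intros B [<-|[]] | now apply D_hyp; left].
Qed.

Lemma provable_mono (T U : theory) A :
  (forall B, T B -> U B) -> provable T A -> provable U A.
Proof.
  intros H (G & HG & HA). exists G. auto.
Qed.

Lemma provable_lift1 (T : theory) A B :
  (forall G, deriv G A -> deriv G B) -> provable T A -> provable T B.
Proof.
  intros H (G & HG & HA). exists G. auto.
Qed.

Lemma provable_lift2 (T : theory) A B C :
  (forall G, deriv G A -> deriv G B -> deriv G C) ->
  provable T A -> provable T B -> provable T C.
Proof.
  intros H (G & HG & HA) (G' & HG' & HB). exists (G ++ G'). split.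
  - intros D HD. apply in_app_or in HD as [|]; auto.
  - apply H; eapply deriv_weaken; eauto using incl_appl, incl_appr, incl_refl.
Qed.

Lemma provable_impE (T : theory) A B :
  provable T (Imp A B) -> provable T A -> provable T B.
Proof.
  apply provable_lift2. intros G. apply D_impE.
Qed.

Lemma extend_context (T : theory) A G :
  (forall B, In B G -> extend T A B) ->
  exists G', (forall B, In B G' -> T B) /\ incl G (A :: G').
Proof.
  induction G as [|B G IH]; intros HG.
  - exists []. split; [easy | now intros C []].
  - destruct IH as (G' & HG' & Hincl).
    { intros C HC. apply HG. now right. }
    destruct (HG B (or_introl eq_refl)) as [HB| ->].
    + exists (B :: G'). split; [now intros C [<-|]; auto|].
      intros C [<-|HC]; [now right; left|].
      destruct (Hincl C HC) as [|]; [now left | now right; right].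
    + exists G'. split; [assumption|]. intros C [<-|HC]; [now left | auto].
Qed.

Lemma provable_impI (T : theory) A B :
  provable (extend T A) B -> provable T (Imp A B).
Proof.
  intros (G & HG & HB). destruct (extend_context T A G HG) as (G' & HG' & Hi).
  exists G'. split; [assumption|]. apply D_impI. eapply deriv_weaken; eauto.
Qed.

Lemma provable_raa (T : theory) A :
  ~ consistent (extend T (Neg A)) -> provable T A.
Proof.
  intros H. apply NNPP, provable_impI in H. revert H. apply provable_lift1.
  intros G H. apply D_raa. apply D_impE with (Neg A); [|now apply D_hyp; left].
  eapply deriv_weaken; [exact H|]. intros B; now right.
Qed.

(** * Henkin extensions *)

(** A variable bounding a theory is fresh for it, which is all that a Henkin
    witness requires. *)
Definition bounded_theory (T : theory) : Prop :=
  exists n, forall B, T B -> bounded n B.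

Lemma bounded_extend T A : bounded_theory T -> bounded_theory (extend T A).
Proof.
  intros [n Hn]. destruct (bounded_exists A) as [m Hm]. exists (n + m).
  intros B [HB| ->];
    [apply bounded_mono with n | apply bounded_mono with m]; auto; lia.
Qed.

(** If a fresh [y] could not be a counterexample to [B], then [B] would be
    provable of [y] and hence of everything. *)
Lemma consistent_witness T B :
  bounded_theory T -> T (Neg (All B)) -> consistent T ->
  exists y, consistent (extend T (Neg (inst y B))).
Proof.
  intros [y Hy] HB HT. exists y. intros H. apply HT.
  apply provable_impE with (All B); [now apply provable_hyp|].
  destruct (provable_raa T (inst y B)) as (G & HG & Hd); [now intros HC|].
  exists G. split; [assumption|]. apply deriv_generalize with y; auto.
  destruct (Hy _ HB) as [Hb _]. exact Hb.
Qed.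

Lemma henkin_step T A :
  consistent T -> bounded_theory T ->
  exists U : theory, (forall B, T B -> U B) /\ consistent U /\ bounded_theory U /\
    (U A \/ ~ consistent (extend T A)) /\
    (forall B, A = Neg (All B) -> U A -> exists y, U (Neg (inst y B))).
Proof.
  intros HT Hb. destruct (classic (consistent (extend T A))) as [HA|HA].
  - assert (Hb' := bounded_extend T A Hb).
    destruct (classic (exists B, A = Neg (All B))) as [[B ->]|HB].
    + destruct (consistent_witness (extend T (Neg (All B))) B) as [y Hy];
        [assumption | now right | assumption |].
      exists (extend (extend T (Neg (All B))) (Neg (inst y B))).
      repeat split; auto using bounded_extend.
      * now left; left.
      * now left; left; right.
      * intros C [= <-] _. exists y. now right.
    + exists (extend T A). repeat split; auto.
      * now left.
      * now left; right.
      * intros B ->. exfalso; eauto.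
  - exists T. repeat split; auto. intros B -> H. exfalso.
    apply HA. intros HC. apply HT. revert HC. apply provable_mono.
    now intros C [| ->].
Qed.

(** Formulas are countable, so that the Henkin construction can run through all
    of them in ω steps. *)
Fixpoint code (A : form) : nat :=
  match A with
  | Bot => to_nat (0, 0)
  | Eq x y => to_nat (1, to_nat (x, y))
  | Mem x y => to_nat (2, to_nat (x, y))
  | Imp B C => to_nat (3, to_nat (code B, code C))
  | All B => to_nat (4, code B)
  end.

Lemma code_inj A : forall B, code A = code B -> A = B.
Proof.
  induction A as [|x y|x y|A1 IHA1 A2 IHA2|A IHA]; intros [] H;
    cbn [code] in H; apply to_nat_inj in H;
    try discriminate; try reflexivity; apply (f_equal snd) in H;
    cbn [snd] in H; try apply to_nat_inj in H;
    try injection H as ? ?; f_equal; auto.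
Qed.

Definition form_of_code (n : nat) : form :=
  epsilon (inhabits Bot) (fun A => code A = n).

Lemma form_of_code_code A : form_of_code (code A) = A.
Proof.
  apply code_inj. unfold form_of_code.
  apply (epsilon_spec (inhabits Bot) (fun B => code B = code A)). now exists A.
Qed.

Lemma henkin_extension T :
  consistent T -> bounded_theory T ->
  exists U : theory, (forall B, T B -> U B) /\ consistent U /\
    (forall A, U A \/ ~ consistent (extend U A)) /\
    (forall B, U (Neg (All B)) -> exists y, U (Neg (inst y B))).
Proof.
  intros HT Hb.
  set (Q := {U : theory | consistent U /\ bounded_theory U}).
  assert (Hstep : forall A (U : Q), exists V : Q,
    (forall B, proj1_sig U B -> proj1_sig V B) /\
    (proj1_sig V A \/ ~ consistent (extend (proj1_sig U) A)) /\
    (forall B, A = Neg (All B) -> proj1_sig V A ->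
       exists y, proj1_sig V (Neg (inst y B)))).
  { intros A [U [HU HUb]]. simpl.
    destruct (henkin_step U A HU HUb) as (V & H1 & H2 & H3 & H4).
    exists (exist _ V (conj H2 H3)). tauto. }
  set (next A U := proj1_sig (constructive_indefinite_description _ (Hstep A U))).
  set (chain := fix chain k : Q := match k with
    | 0 => exist _ T (conj HT Hb)
    | S k => next (form_of_code k) (chain k)
    end).
  assert (Hnext : forall k, let A := form_of_code k in
    (forall B, proj1_sig (chain k) B -> proj1_sig (chain (S k)) B) /\
    (proj1_sig (chain (S k)) A \/ ~ consistent (extend (proj1_sig (chain k)) A)) /\
    (forall B, A = Neg (All B) -> proj1_sig (chain (S k)) A ->
       exists y, proj1_sig (chain (S k)) (Neg (inst y B)))).
  { intros k. exact (proj2_sig (constructive_indefinite_description _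
                                  (Hstep (form_of_code k) (chain k)))). }
  assert (Hmono : forall k l, k <= l -> forall B,
    proj1_sig (chain k) B -> proj1_sig (chain l) B).
  { induction 1; auto. intros B HB. apply Hnext; auto. }
  set (U := fun B => exists k, proj1_sig (chain k) B).
  assert (HU : consistent U).
  { intros (G & HG & Hd).
    assert (exists k, forall B, In B G -> proj1_sig (chain k) B) as [k Hk].
    { clear Hd. induction G as [|B G IH]; [now exists 0|].
      destruct IH as [k Hk].
      { intros C HC. apply HG. now right. }
      destruct (HG B (or_introl eq_refl)) as [l Hl]. exists (k + l).
      intros C [<-|HC]; [apply Hmono with l | apply Hmono with k]; auto; lia. }
    apply (proj1 (proj2_sig (chain k))). now exists G. }
  exists U. split; [now exists 0|]. split; [assumption|]. split.
  - intros A. destruct (Hnext (code A)) as (_ & [H|H] & _);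
      rewrite form_of_code_code in H.
    + left. now exists (S (code A)).
    + right. intros HA. apply H. intros HC. apply HA. revert HC.
      apply provable_mono. intros B [HB| ->]; [left; now exists (code A) | now right].
  - intros B [k Hk].
    destruct (Hnext (code (Neg (All B)))) as (_ & H & Hw). rewrite form_of_code_code in *.
    destruct (Hw B eq_refl) as [y Hy]; [|now exists y, (S (code (Neg (All B))))].
    destruct H as [H|H]; [assumption|]. exfalso. apply H. intros HC.
    apply HU. revert HC. apply provable_mono.
    intros C [HC| ->]; [now exists (code (Neg (All B))) | now exists k].
Qed.

(** * The term model and completeness *)

Lemma sat_ext (M : structure) A : forall e f : nat -> M,
  (forall i, e i = f i) -> sat M e A <-> sat M f A.
Proof.
  induction A as [|x y|x y|A1 IHA1 A2 IHA2|A IHA]; simpl; intros e f H; rewrite ?H; try reflexivity.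
  - now rewrite (IHA1 e f), (IHA2 e f).
  - split; intros HA a; specialize (HA a); eapply IHA; try eassumption;
      now intros [|i]; simpl.
Qed.

Section Henkin_model.

Variable U : theory.
Hypothesis U_consistent : consistent U.
Hypothesis U_complete : forall A, U A \/ ~ consistent (extend U A).
Hypothesis U_witness :
  forall B, U (Neg (All B)) -> exists y, U (Neg (inst y B)).

Lemma henkin_closed A : provable U A -> U A.
Proof.
  intros HA. destruct (U_complete A) as [|H]; [assumption|].
  exfalso. apply H. intros HC. apply U_consistent.
  apply provable_impE with A; [now apply provable_impI | assumption].
Qed.

Lemma henkin_neg A : U (Neg A) <-> ~ U A.
Proof.
  split.
  - intros HN HA. apply U_consistent.
    apply provable_impE with A; now apply provable_hyp.
  - intros HA. destruct (U_complete A) as [|H]; [contradiction|].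
    apply henkin_closed, provable_impI. now apply NNPP.
Qed.

Definition var_eq (x y : nat) : Prop := U (Eq x y).

Lemma var_eq_refl x : var_eq x x.
Proof.
  apply henkin_closed. exists []. split; [easy | apply D_eqI].
Qed.

(** Symmetry, transitivity and compatibility with membership are all instances of
    this substitution property, for suitable atomic [A]. *)
Lemma var_eq_subst A x y : var_eq x y -> U (inst x A) -> U (inst y A).
Proof.
  intros Hxy HA. apply henkin_closed.
  apply provable_lift2 with (Eq x y) (inst x A); try now apply provable_hyp.
  intros G. apply D_eqE.
Qed.

Lemma var_eq_sym x y : var_eq x y -> var_eq y x.
Proof.
  intros H. apply (var_eq_subst (Eq 0 (S x)) x y H), var_eq_refl.
Qed.

Lemma var_eq_trans x y z : var_eq x y -> var_eq y z -> var_eq x z.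
Proof.
  intros H1 H2. exact (var_eq_subst (Eq (S x) 0) y z H2 H1).
Qed.

Definition henkin_model : structure := {|
  carrier := quotient var_eq;
  mem a b := exists x y,
    a = class_of var_eq x /\ b = class_of var_eq y /\ U (Mem x y);
  carrier_nonempty := inhabits (class_of var_eq 0)
|}.

Lemma henkin_class_eq x y :
  class_of var_eq x = class_of var_eq y <-> U (Eq x y).
Proof.
  apply class_of_eq; eauto using var_eq_refl, var_eq_sym, var_eq_trans.
Qed.

(** Generalised over renamings, since elements of the term model are classes of
    variables and valuations are thus renamings followed by the projection. *)
Lemma henkin_truth A : forall r,
  sat henkin_model (fun n => class_of var_eq (r n)) A <-> U (rename r A).
Proof.
  induction A as [|x y|x y|A IHA B IHB|A IH]; intros r; simpl.
  - split; [easy|]. intros H. apply U_consistent. now apply provable_hyp.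
  - apply henkin_class_eq.
  - split; [|now exists (r x), (r y)].
    intros (u & v & Hu & Hv & H).
    apply henkin_class_eq, var_eq_sym in Hu, Hv.
    apply (var_eq_subst (Mem (S (r x)) 0) v _ Hv).
    exact (var_eq_subst (Mem 0 (S v)) u _ Hu H).
  - rewrite IHA, IHB. split.
    + intros H. destruct (classic (U (rename r A))) as [HA|HA].
      * apply henkin_closed, provable_impI, provable_hyp. now left; auto.
      * apply henkin_closed, provable_impI.
        apply (provable_lift2 _ (Neg (rename r A)) (rename r A)).
        -- intros G H1 H2. apply D_raa. eapply deriv_weaken.
           ++ eapply D_impE; eassumption.
           ++ intros C; now right.
        -- apply provable_hyp. left. now apply henkin_neg.
        -- apply provable_hyp. now right.
    + intros H HA. apply henkin_closed.
      eapply provable_impE; apply provable_hyp; eassumption.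
  - assert (Hinst : forall y, sat henkin_model
        (scons (class_of var_eq y) (fun n => class_of var_eq (r n))) A <->
        U (inst y (rename (up r) A))).
    { intros y. unfold inst. rewrite rename_comp.
      rewrite (rename_ext _ _ (scons y r)) by now intros [|i].
      rewrite <- IH. apply sat_ext. now intros [|i]. }
    split.
    + intros H. apply NNPP. intros HN. apply henkin_neg in HN.
      destruct (U_witness _ HN) as [y Hy]. apply henkin_neg in Hy.
      apply Hy, Hinst, H.
    + intros H a. destruct (class_of_surj _ a) as [y ->]. apply Hinst.
      apply henkin_closed. eapply provable_lift1; [|apply provable_hyp, H].
      intros G. apply D_allE.
Qed.

End Henkin_model.

Lemma completeness (T : theory) A :
  (forall B, T B -> bounded 0 B) ->
  (forall M, model M T -> holds M A) -> provable T A.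
Proof.
  intros HT H. apply provable_raa. intros HC.
  destruct (henkin_extension _ HC) as (U & HU & H1 & H2 & H3).
  { apply bounded_extend. now exists 0. }
  assert (HN : ~ U A).
  { apply henkin_neg; auto. apply HU. now right. }
  apply HN. rewrite <- (rename_id A).
  apply henkin_truth; auto. apply H.
  intros B HB e.
  (* every valuation comes from a renaming, and renamings fix the axioms *)
  assert (exists r, e = fun n => class_of (var_eq U) (r n)) as [r ->].
  { destruct (choice (fun n x => e n = class_of (var_eq U) x)) as [r Hr].
    - intros n. apply class_of_surj.
    - exists r. now apply functional_extensionality. }
  apply henkin_truth; auto. rewrite rename_closed by auto. apply HU. now left.
Qed.

(** * Satisfaction *)

Lemma sat_rename (M : structure) A : forall (e : nat -> M) r,
  sat M e (rename r A) <-> sat M (fun n => e (r n)) A.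
Proof.
  induction A as [|x y|x y|A IHA B IHB|A IH]; simpl; intros e r; try reflexivity.
  - now rewrite IHA, IHB.
  - split; intros H a; specialize (H a);
      [apply IH in H | apply IH]; revert H; apply sat_ext; now intros [|i].
Qed.

Lemma holds_all (M : structure) A : holds M (All A) <-> holds M A.
Proof.
  split; intros H e.
  - generalize (H (fun n => e (S n)) (e 0)). apply sat_ext. now intros [|n].
  - intros a. apply H.
Qed.

Lemma holds_iter_all (M : structure) A n :
  holds M (Nat.iter n All A) <-> holds M A.
Proof.
  induction n as [|n IH]; [reflexivity|]. cbn [Nat.iter nat_rect].
  rewrite holds_all. exact IH.
Qed.

Lemma sat_bounded (M : structure) A : forall n (e f : nat -> M),
  bounded n A -> (forall i, i < n -> e i = f i) -> sat M e A <-> sat M f A.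
Proof.
  induction A as [|x y|x y|A IHA B IHB|A IH]; simpl; intros n e f HA H.
  - reflexivity.
  - now rewrite !H.
  - now rewrite !H.
  - destruct HA. now rewrite (IHA n e f), (IHB n e f).
  - split; intros H' a; specialize (H' a); revert H'; eapply IH; try exact HA;
      intros [|i] Hi; simpl; rewrite ?H by lia; reflexivity.
Qed.

(** * Set-theoretic notions in a structure *)

Declare Scope set_scope.
Notation "x ∈ y" := (mem _ x y) : set_scope.
Local Open Scope set_scope.

Section Predicates.

Context {M : structure}.
Implicit Types a b f p r s u w : M.

(** Each notion repeats the shape of the formula that expresses it, so that
    unfolding both sides reduces their equivalence to the connectives. *)
Definition Empty a := forall x, ~ x ∈ a.
Definition Subset a b := forall x, x ∈ a -> x ∈ b.
Definition Pair p a b := forall x, x ∈ p <-> x = a \/ x = b.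
Definition Union u a := forall x, x ∈ u <-> exists y, y ∈ a /\ x ∈ y.
Definition Power p a := forall x, x ∈ p <-> Subset x a.
Definition Succ s a := forall x, x ∈ s <-> x ∈ a \/ x = a.
Definition Inductive_set w :=
  (exists x, Empty x /\ x ∈ w) /\
  (forall x, x ∈ w -> exists y, Succ y x /\ y ∈ w).
Definition Omega w :=
  Inductive_set w /\ forall v, Inductive_set v -> Subset w v.
Definition OPair p a b :=
  exists u v, Pair u a a /\ Pair v a b /\ Pair p u v.
Definition Related r a b := exists p, OPair p a b /\ p ∈ r.
Definition Relation r a b :=
  forall p, p ∈ r -> exists x y, x ∈ a /\ y ∈ b /\ OPair p x y.
Definition Function f a b :=
  Relation f a b /\
  forall x, x ∈ a ->
    exists y, Related f x y /\ forall z, Related f x z -> z = y.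
Definition Bijection f a b :=
  Function f a b /\
  forall y, y ∈ b ->
    exists x, Related f x y /\ forall z, Related f z y -> z = x.
Definition Equipotent a b := exists f, Bijection f a b.
Definition Finite a := exists w n, Omega w /\ n ∈ w /\ Equipotent a n.
Definition Dedekind_infinite a :=
  exists b, Subset b a /\ b <> a /\ Equipotent b a.
Definition Countable_choice := forall w b r,
  Omega w -> Relation r w b ->
  (forall n, n ∈ w -> exists y, y ∈ b /\ Related r n y) ->
  exists f, Function f w b /\
    forall n, n ∈ w -> exists y, Related f n y /\ Related r n y.

Lemma sat_neg e A (P : Prop) : (sat M e A <-> P) -> (sat M e (Neg A) <-> ~ P).
Proof. simpl. tauto. Qed.

Lemma sat_imp e A B (P Q : Prop) : (sat M e A <-> P) -> (sat M e B <-> Q) ->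
  (sat M e (Imp A B) <-> (P -> Q)).
Proof. simpl. tauto. Qed.

Lemma sat_and e A B (P Q : Prop) : (sat M e A <-> P) -> (sat M e B <-> Q) ->
  (sat M e (And A B) <-> P /\ Q).
Proof. simpl. destruct (classic P), (classic Q); tauto. Qed.

Lemma sat_or e A B (P Q : Prop) : (sat M e A <-> P) -> (sat M e B <-> Q) ->
  (sat M e (Or A B) <-> P \/ Q).
Proof. simpl. destruct (classic P), (classic Q); tauto. Qed.

Lemma sat_iff e A B (P Q : Prop) : (sat M e A <-> P) -> (sat M e B <-> Q) ->
  (sat M e (Iff A B) <-> (P <-> Q)).
Proof. intros HA HB. now apply sat_and; apply sat_imp. Qed.

Lemma sat_all e A (P : M -> Prop) : (forall a, sat M (scons a e) A <-> P a) ->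
  (sat M e (All A) <-> forall a, P a).
Proof. simpl. firstorder. Qed.

Lemma sat_ex e A (P : M -> Prop) : (forall a, sat M (scons a e) A <-> P a) ->
  (sat M e (Ex A) <-> exists a, P a).
Proof.
  intros H. unfold Ex. rewrite (sat_neg _ _ (forall a, ~ P a)).
  - split; [|firstorder]. intros HN. apply NNPP. firstorder.
  - apply sat_all. intros a. now apply sat_neg.
Qed.

End Predicates.

Ltac decode_step :=
  lazymatch goal with
  | |- sat _ _ (Neg _) <-> _ => apply sat_neg
  | |- sat _ _ (And _ _) <-> _ => apply sat_and
  | |- sat _ _ (Or _ _) <-> _ => apply sat_or
  | |- sat _ _ (Iff _ _) <-> _ => apply sat_iff
  | |- sat _ _ (Ex _) <-> _ => apply sat_ex; intro
  | |- sat _ _ (Imp _ _) <-> _ => apply sat_imp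
  | |- sat _ _ (All _) <-> _ => apply sat_all; intro
  | |- sat _ _ (Eq _ _) <-> _ => reflexivity
  | |- sat _ _ (Mem _ _) <-> _ => reflexivity
  end.

Ltac decode :=
  unfold SD, AC_aleph0, standard_infinite, dedekind_infinite, is_finite,
    equipotent, is_bijection, is_function, is_relation, related, is_opair,
    is_omega, inductive_set, is_succ, is_power, is_union, is_pair, subset,
    is_empty;
  unfold Countable_choice, Dedekind_infinite, Finite, Equipotent, Bijection,
    Function, Relation, Related, OPair, Omega, Inductive_set, Succ, Power,
    Union, Pair, Subset, Empty;
  repeat decode_step.

Lemma holds_SD (M : structure) :
  holds M SD <-> forall a : M, ~ Finite a -> Dedekind_infinite a.
Proof.
  assert (H : forall e, sat M e SD <-> forall a : M, ~ Finite a -> Dedekind_infinite a).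
  { intros e. decode. }
  split; [|intros; intros e; now apply H].
  intros HSD. destruct (carrier_nonempty M) as [a]. apply (H (fun _ => a)), HSD.
Qed.

Lemma holds_AC (M : structure) : holds M AC_aleph0 <-> @Countable_choice M.
Proof.
  assert (H : forall e, sat M e AC_aleph0 <-> @Countable_choice M).
  { intros e. decode. }
  split; [|intros; intros e; now apply H].
  intros HSD. destruct (carrier_nonempty M) as [a]. apply (H (fun _ => a)), HSD.
Qed.

(** * Definable predicates with parameters *)

(** Comprehension and induction in a model apply to definable predicates only.
    Definability is stated for predicates on valuations: closure under the
    connectives and quantifiers then lets a tactic recognise definable
    predicates by their syntactic form, and no formula has to be written in
    de Bruijn notation. *)
Section Definability.

Context {M : structure}.

Definition value (e : nat -> M) (t : nat + M) : M :=
  match t with inl i => e i | inr u => u end.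

(** A variable of the defining formula is either a variable of the predicate or a
    parameter, as [t] says. *)
Definition definable (P : (nat -> M) -> Prop) : Prop :=
  exists (A : form) (t : nat -> nat + M),
    forall e, sat M (fun k => value e (t k)) A <-> P e.

Definition is_term (s : (nat -> M) -> M) : Prop :=
  exists t, forall e, value e t = s e.

Lemma term_var i : is_term (fun e => e i).
Proof. now exists (inl i). Qed.

Lemma term_param u : is_term (fun _ => u).
Proof. now exists (inr u). Qed.

Lemma definable_mem s t : is_term s -> is_term t ->
  definable (fun e => s e ∈ t e).
Proof.
  intros [a Ha] [b Hb]. exists (Mem 0 1), (fun k : nat => if k then a else b).
  intros e. simpl. now rewrite Ha, Hb.
Qed.

Lemma definable_eq s t : is_term s -> is_term t ->
  definable (fun e => s e = t e).
Proof.
  intros [a Ha] [b Hb]. exists (Eq 0 1), (fun k : nat => if k then a else b).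
  intros e. simpl. now rewrite Ha, Hb.
Qed.

Lemma definable_const (P : Prop) : definable (fun _ => P).
Proof.
  destruct (classic P).
  - exists (Imp Bot Bot), (fun k => inl k). simpl. tauto.
  - exists Bot, (fun k => inl k). simpl. tauto.
Qed.

(** The variables of the two formulas are interleaved as the even and the odd
    ones, because their assignments of parameters are independent. *)
Lemma definable_imp P Q : definable P -> definable Q ->
  definable (fun e => P e -> Q e).
Proof.
  intros (A & s & HA) (B & t & HB).
  exists (Imp (rename (fun k => 2 * k) A) (rename (fun k => S (2 * k)) B)).
  exists (fun k => if Nat.even k then s (Nat.div2 k) else t (Nat.div2 k)).
  intros e. cbn [sat]. rewrite !sat_rename, <- HA, <- HB.
  rewrite (sat_ext M A _ (fun k => value e (s k))).
  - rewrite (sat_ext M B _ (fun k => value e (t k))); [reflexivity|].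
    intros i. now rewrite Nat.even_succ, Nat.odd_mul, Nat.div2_succ_double.
  - intros i. now rewrite Nat.even_mul, Nat.div2_double.
Qed.

Lemma definable_all (P : M -> (nat -> M) -> Prop) :
  definable (fun e => P (e 0) (fun n => e (S n))) ->
  definable (fun e => forall a, P a e).
Proof.
  intros (A & t & HA).
  exists (All (rename
    (fun k => match t k with inl 0 => 0 | _ => S k end) A)).
  exists (fun k => match t k with inl (S i) => inl i | u => u end).
  intros e. cbn [sat]. apply Morphisms_Prop.all_iff_morphism. intros a.
  rewrite sat_rename.
  change (P a e) with ((fun e => P (e 0) (fun n => e (S n))) (scons a e)).
  rewrite <- HA. apply sat_ext. intros k.
  destruct (t k) as [[|i]|u] eqn:E; simpl; now rewrite ?E.
Qed.

Lemma definable_iff_ext P Q : (forall e, P e <-> Q e) ->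
  definable P -> definable Q.
Proof.
  intros H (A & t & HA). exists A, t. intros e. now rewrite HA.
Qed.

Lemma definable_subst P (t : nat -> nat + M) :
  definable P -> definable (fun e => P (fun i => value e (t i))).
Proof.
  intros (A & s & HA).
  exists A, (fun k => match s k with inl i => t i | inr u => inr u end).
  intros e. rewrite <- HA. apply sat_ext. intros k. now destruct (s k).
Qed.

Lemma definable_app1 (P : M -> Prop) r :
  definable (fun e => P (e 0)) -> is_term r -> definable (fun e => P (r e)).
Proof.
  intros HP [a Ha]. eapply definable_iff_ext;
    [|apply (definable_subst _ (fun _ => a) HP)].
  intros e. simpl. now rewrite Ha.
Qed.

Lemma definable_app2 (P : M -> M -> Prop) r s :
  definable (fun e => P (e 0) (e 1)) -> is_term r -> is_term s ->
  definable (fun e => P (r e) (s e)).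
Proof.
  intros HP [a Ha] [b Hb]. eapply definable_iff_ext;
    [|apply (definable_subst _ (fun k : nat => if k then a else b) HP)].
  intros e. simpl. now rewrite Ha, Hb.
Qed.

Lemma definable_not P : definable P -> definable (fun e => ~ P e).
Proof. intros HP. apply (definable_imp P), definable_const. exact HP. Qed.

Lemma definable_and P Q : definable P -> definable Q ->
  definable (fun e => P e /\ Q e).
Proof.
  intros HP HQ.
  apply (definable_iff_ext (fun e => ~ (P e -> ~ Q e))).
  - intros e. destruct (classic (P e)), (classic (Q e)); tauto.
  - apply definable_not, definable_imp, definable_not; assumption.
Qed.

Lemma definable_or P Q : definable P -> definable Q ->
  definable (fun e => P e \/ Q e).
Proof.
  intros HP HQ. apply (definable_iff_ext (fun e => ~ P e -> Q e)).
  - intros e. destruct (classic (P e)); tauto.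
  - apply definable_imp; [apply definable_not|]; assumption.
Qed.

Lemma definable_iff P Q : definable P -> definable Q ->
  definable (fun e => P e <-> Q e).
Proof. intros. apply definable_and; now apply definable_imp. Qed.

Lemma definable_ex (P : M -> (nat -> M) -> Prop) :
  definable (fun e => P (e 0) (fun n => e (S n))) ->
  definable (fun e => exists a, P a e).
Proof.
  intros HP. apply (definable_iff_ext (fun e => ~ forall a, ~ P a e)).
  - intros e. split; [|firstorder]. intros H. apply NNPP. firstorder.
  - now apply definable_not, definable_all, definable_not.
Qed.

End Definability.

Ltac define_step :=
  cbv beta;
  lazymatch goal with
  | |- is_term (fun e => e _) => apply term_var
  | |- is_term _ => apply term_param
  | |- definable (fun e => forall a : carrier _, _) => apply definable_all
  | |- definable (fun e => _ ∈ _) => apply definable_mem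
  | |- definable (fun e => _ = _) => apply definable_eq
  | |- definable (fun e => ~ _) => apply definable_not
  | |- definable (fun e => _ /\ _) => apply definable_and
  | |- definable (fun e => _ \/ _) => apply definable_or
  | |- definable (fun e => _ <-> _) => apply definable_iff
  | |- definable (fun e => _ -> _) => apply definable_imp
  | |- definable (fun e => exists a, _) => apply definable_ex
  end.

Ltac define := repeat define_step.

(** * Elementary set theory in a model of Z *)

Section Zermelo.

Context {M : structure} (HZ : model M theory_Z).
Implicit Types a b f g m n p r s u w x y z X : M.

Lemma extensionality x y : (forall z, z ∈ x <-> z ∈ y) -> x = y.
Proof.
  intros H. apply (HZ _ Z_extensionality (fun _ => x) y x). intros z.
  specialize (H z). simpl. tauto.
Qed.

(** The parameters are free variables of an instance of comprehension; the
    variables that stand for the argument of [P] are all identified with the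
    separated variable 0. *)
Lemma separation (P : M -> Prop) : definable (fun e => P (e 0)) ->
  forall a, exists b, forall x, x ∈ b <-> x ∈ a /\ P x.
Proof.
  intros (A & t & HA) a.
  (* [e] holds the parameters, which the separated variable shifts by one *)
  set (r := fun k => match t k with inl _ => 0 | inr _ => S k end).
  set (e := fun k => match t k with inl _ => a | inr u => u end).
  set (B := rename r A). destruct (bounded_exists B) as [n Hn].
  assert (Hax : holds M (ax_comprehension n B)).
  { apply HZ, Z_comprehension. eapply bounded_mono; [|exact Hn]. lia. }
  unfold ax_comprehension in Hax. rewrite holds_iter_all in Hax.
  generalize (Hax e a). apply sat_ex.
  intros b. apply sat_all. intros x. apply sat_iff; [reflexivity|].
  apply sat_and; [reflexivity|]. unfold B. rewrite !sat_rename.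
  rewrite <- (HA (fun _ => x)). apply sat_ext. intros k. unfold r, e.
  destruct (t k) eqn:E; simpl; now rewrite ?E.
Qed.

Lemma empty_exists : exists x, Empty x.
Proof.
  destruct (carrier_nonempty M) as [a].
  assert (H : sat M (fun _ => a) ax_null) by apply HZ, Z_null.
  revert H. apply sat_ex. intros x. decode.
Qed.

Lemma pair_exists a b : exists p, Pair p a b.
Proof.
  generalize (HZ _ Z_pair (fun _ => a) b a). apply sat_ex. intros x. decode.
Qed.

Lemma union_exists a : exists u, Union u a.
Proof.
  generalize (HZ _ Z_union (fun _ => a) a). apply sat_ex. intros x. decode.
Qed.

Lemma power_exists a : exists p, Power p a.
Proof.
  generalize (HZ _ Z_power (fun _ => a) a). apply sat_ex. intros x. decode.
Qed.

Lemma inductive_exists : exists w, Inductive_set w.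
Proof.
  destruct (carrier_nonempty M) as [a].
  generalize (HZ _ Z_infinity (fun _ => a)). apply sat_ex. intros x. decode.
Qed.

Lemma omega_exists : exists w, Omega w.
Proof.
  destruct inductive_exists as [v Hv].
  destruct (separation (fun x => forall u, Inductive_set u -> x ∈ u)) with v
    as [w Hw].
  { unfold Inductive_set, Empty, Succ. define. }
  exists w. split; [split|].
  - destruct Hv as [[x [Hx Hxv]] _]. exists x. split; [assumption|].
    apply Hw. split; [assumption|]. intros u [[y [Hy Hyu]] _].
    replace x with y; [assumption|]. apply extensionality. firstorder.
  - intros x [Hxv Hx]%Hw. destruct (proj2 Hv x Hxv) as [s [Hs Hsv]].
    exists s. split; [assumption|]. apply Hw. split; [assumption|].
    intros u Hu. destruct (proj2 Hu x (Hx u Hu)) as [s' [Hs' Hsu]].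
    replace s with s'; [assumption|]. apply extensionality. intros z.
    now rewrite (Hs z), (Hs' z).
  - intros u Hu x [_ Hx]%Hw. auto.
Qed.

Lemma binary_union_exists a b :
  exists c, forall x, x ∈ c <-> x ∈ a \/ x ∈ b.
Proof.
  destruct (pair_exists a b) as [p Hp], (union_exists p) as [c Hc].
  exists c. intros x. rewrite (Hc x). split.
  - intros (y & [->| ->]%Hp & Hx); auto.
  - intros [H|H]; [exists a | exists b]; (split; [apply Hp; auto | assumption]).
Qed.

Lemma succ_exists a : exists s, Succ s a.
Proof.
  destruct (pair_exists a a) as [p Hp], (binary_union_exists a p) as [c Hc].
  exists c. intros x. rewrite (Hc x), (Hp x). tauto.
Qed.

Lemma opair_exists a b : exists p, OPair p a b.
Proof.
  destruct (pair_exists a a) as [u Hu], (pair_exists a b) as [v Hv],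
    (pair_exists u v) as [p Hp]. now exists p, u, v.
Qed.

Lemma opair_inj p a b c d : OPair p a b -> OPair p c d -> a = c /\ b = d.
Proof.
  intros (u & v & Hu & Hv & Hp) (u' & v' & Hu' & Hv' & Hp').
  unfold Pair in *.
  assert (a = c).
  { assert (H : c ∈ u).
    { destruct (proj1 (Hp' u)) as [->| ->].
      - apply Hp; auto.
      - apply Hu'; auto.
      - apply Hv'; auto. }
    apply Hu in H. destruct H; congruence. }
  subst c. split; [reflexivity|].
  assert (Hd : d = a \/ d = b).
  { destruct (proj1 (Hp v')) as [E|E]; [apply Hp'; auto| |].
    - left. destruct (proj1 (Hu d)); auto. rewrite <- E. apply Hv'; auto.
    - apply Hv. rewrite <- E. apply Hv'; auto. }
  assert (Hb : b = a \/ b = d).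
  { destruct (proj1 (Hp' v)) as [E|E]; [apply Hp; auto| |].
    - left. destruct (proj1 (Hu' b)); auto. rewrite <- E. apply Hv; auto.
    - apply Hv'. rewrite <- E. apply Hv; auto. }
  destruct Hd, Hb; congruence.
Qed.

Lemma opairs_bounded a b :
  exists c, forall x y p, x ∈ a -> y ∈ b -> OPair p x y -> p ∈ c.
Proof.
  destruct (binary_union_exists a b) as [d Hd], (power_exists d) as [q Hq],
    (power_exists q) as [c Hc].
  exists c. intros x y p Hx Hy (u & v & Hu & Hv & Hp).
  apply Hc. intros z [->| ->]%Hp; apply Hq.
  - intros t [->| ->]%Hu; apply Hd; auto.
  - intros t [->| ->]%Hv; apply Hd; auto.
Qed.

(** Relations are used through what they relate; the encoding of pairs matters only
    when a set of pairs is built. *)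
Lemma related_graph (P : M -> M -> Prop) r a b :
  (forall p, p ∈ r <-> exists x y, x ∈ a /\ y ∈ b /\ P x y /\ OPair p x y) ->
  Relation r a b /\ forall x y, Related r x y <-> x ∈ a /\ y ∈ b /\ P x y.
Proof.
  intros Hr. split.
  - intros p (x & y & Hx & Hy & _ & Hp)%Hr. now exists x, y.
  - intros x y. split.
    + intros (p & Hp & (x' & y' & Hx & Hy & HP & Hp')%Hr).
      destruct (opair_inj p x y x' y') as [-> ->]; auto.
    + intros (Hx & Hy & HP). destruct (opair_exists x y) as [p Hp].
      exists p. split; [assumption|]. apply Hr. now exists x, y.
Qed.

Lemma relation_exists (P : M -> M -> Prop) :
  definable (fun e => P (e 0) (e 1)) -> forall a b, exists r,
  Relation r a b /\ forall x y, Related r x y <-> x ∈ a /\ y ∈ b /\ P x y.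
Proof.
  intros HP a b. destruct (opairs_bounded a b) as [c Hc].
  destruct (separation (fun p =>
    exists x y, x ∈ a /\ y ∈ b /\ P x y /\ OPair p x y)) with c as [r Hr].
  { unfold OPair, Pair. define. apply (definable_app2 P); define; exact HP. }
  exists r. apply related_graph. intros p. rewrite (Hr p).
  split; [tauto|]. intros H. split; [|assumption].
  destruct H as (x & y & Hx & Hy & _ & Hp). now apply (Hc x y p).
Qed.

End Zermelo.

(** * Numbers and finite sets in a model of Z *)

(** Only the restriction of [f] to [n] matters, so that one [f] serves all
    smaller numbers and all larger codomains. *)
Definition injects {M : structure} (f n a : M) : Prop :=
  (forall i, i ∈ n -> exists y, Related f i y) /\
  (forall i y, i ∈ n -> Related f i y -> y ∈ a) /\
  (forall i y z, i ∈ n -> Related f i y -> Related f i z -> y = z) /\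
  (forall i j y, i ∈ n -> j ∈ n -> Related f i y -> Related f j y -> i = j).

(** A form of infinity for which removing an element is easy. *)
Definition large {M : structure} (w a : M) : Prop :=
  forall n, n ∈ w -> exists f, injects f n a.

Ltac define_sets :=
  unfold large, injects, Relation, Related, OPair, Pair, Succ, Empty; define.

Section Induction.

Context {M : structure} (HZ : model M theory_Z).
Implicit Types a b f g i j k m n p r s u x y z X : M.

(** The witness is the range of the injection, with the inverse injection as its
    bijection onto [X]. *)
Lemma injection_dedekind_infinite X r z :
  (forall x, x ∈ X -> exists y, y ∈ X /\ Related r x y) ->
  (forall x y y', Related r x y -> Related r x y' -> y = y') ->
  (forall x x' y, Related r x y -> Related r x' y -> x = x') ->
  z ∈ X -> (forall x, x ∈ X -> ~ Related r x z) ->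
  Dedekind_infinite X.
Proof.
  intros Htot Hfun Hinj Hz Hmiss.
  destruct (separation HZ (fun y => exists x, x ∈ X /\ Related r x y)) with X
    as [B HB]; [define_sets|].
  destruct (relation_exists HZ (fun y x => Related r x y)) with B X
    as (g & Hg & Hrel); [define_sets|].
  exists B. split; [now intros y [Hy _]%HB|]. split.
  - intros ->. destruct (proj1 (HB z) Hz) as (_ & x & Hx & Hxz).
    exact (Hmiss x Hx Hxz).
  - exists g. split; [split; [assumption|]|].
    + intros y Hy. destruct (proj1 (HB y) Hy) as (HyX & x & Hx & Hxy).
      exists x. split; [now apply Hrel|].
      intros x' (_ & _ & Hx')%Hrel. eauto.
    + intros x Hx. destruct (Htot x Hx) as (y & Hy & Hxy).
      assert (y ∈ B) by (apply HB; eauto).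
      exists y. split; [now apply Hrel|].
      intros y' (_ & _ & Hy')%Hrel. eauto.
Qed.

Variable w : M.
Hypothesis Hw : Omega w.

Lemma zero_in_omega x : Empty x -> x ∈ w.
Proof.
  intros Hx. destruct Hw as [[[y [Hy Hyw]] _] _].
  replace x with y; [assumption|]. apply (extensionality HZ). firstorder.
Qed.

Lemma succ_in_omega n s : n ∈ w -> Succ s n -> s ∈ w.
Proof.
  intros Hn Hs. destruct Hw as [[_ H] _]. destruct (H n Hn) as (t & Ht & Htw).
  replace s with t; [assumption|]. apply (extensionality HZ).
  intros z. now rewrite (Hs z), (Ht z).
Qed.

Lemma omega_induction (P : M -> Prop) : definable (fun e => P (e 0)) ->
  (forall z, Empty z -> P z) ->
  (forall n s, n ∈ w -> P n -> Succ s n -> P s) ->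
  forall n, n ∈ w -> P n.
Proof.
  intros HP H0 HS n Hn.
  destruct (separation HZ P HP w) as [v Hv]. apply Hv, Hw, Hn. split.
  - destruct (empty_exists HZ) as [z Hz]. exists z. split; [assumption|].
    apply Hv. auto using zero_in_omega.
  - intros m [Hm HPm]%Hv. destruct (succ_exists HZ m) as [s Hs].
    exists s. split; [assumption|]. apply Hv. eauto using succ_in_omega.
Qed.

End Induction.

Ltac number_induction HZ Hw :=
  lazymatch goal with
  | |- forall n, n ∈ ?w -> @?P n =>
      refine (omega_induction HZ w Hw P _ _ _); cbv beta; [try solve [define_sets]| | ]
  end.

Section Numbers.

Context {M : structure} (HZ : model M theory_Z).
Implicit Types a b f g i j k m n p r s u x y z X : M.
Variable w : M.
Hypothesis Hw : Omega w.

Lemma omega_transitive n : n ∈ w -> forall x, x ∈ n -> x ∈ w.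
Proof.
  revert n. number_induction HZ Hw; [firstorder|].
  intros n s Hn IH Hs x [Hx|Hx]%Hs; [auto | now subst].
Qed.

Lemma number_transitive n : n ∈ w -> forall x y, y ∈ x -> x ∈ n -> y ∈ n.
Proof.
  revert n. number_induction HZ Hw; [firstorder|].
  intros n s Hn IH Hs x y Hy [Hx|Hx]%Hs; apply Hs; left; [eauto | now subst].
Qed.

Lemma number_irreflexive n : n ∈ w -> ~ n ∈ n.
Proof.
  revert n. number_induction HZ Hw; [firstorder|].
  intros n s Hn IH Hs H. apply IH.
  assert (n ∈ s) by (apply Hs; auto).
  apply Hs in H. destruct H as [H|H]; [|congruence].
  now apply (number_transitive n Hn s).
Qed.

Lemma number_trichotomy m n : m ∈ w -> n ∈ w -> m ∈ n \/ m = n \/ n ∈ m.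
Proof.
  intros Hm Hn. revert m Hm. number_induction HZ Hw.
  - intros z Hz. revert n Hn.
    number_induction HZ Hw.
    + intros z' Hz'. right; left. apply (extensionality HZ). firstorder.
    + intros n s Hn [H|[H|H]] Hs.
      * left. apply Hs. auto.
      * left. apply Hs. auto.
      * now apply Hz in H.
  - intros m s Hm IH Hs.
    assert (H : m ∈ n -> s ∈ n \/ s = n).
    { clear IH. revert n Hn. number_induction HZ Hw; [firstorder|].
      intros n t Hn IH Ht [H|H]%Ht.
      - left. apply Ht. auto.
      - subst. right. apply (extensionality HZ). intros z.
        now rewrite (Hs z), (Ht z). }
    destruct IH as [H'|[->|H']]; [tauto| |]; right; right; apply Hs; auto.
Qed.

(** Otherwise induction shows that no number has an element satisfying [P]. *)
Lemma omega_least (P : M -> Prop) n : definable (fun e => P (e 0)) ->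
  n ∈ w -> P n -> exists m, m ∈ w /\ P m /\ forall k, k ∈ m -> ~ P k.
Proof.
  intros HP Hn HPn. apply NNPP. intros Hno.
  assert (H : forall m, m ∈ w -> forall k, k ∈ m -> ~ P k).
  { number_induction HZ Hw.
    - define. apply (definable_app1 P); [exact HP | define].
    - firstorder.
    - intros m s Hm IH Hs k [Hk|Hk]%Hs; [auto|]. subst k. firstorder. }
  apply Hno. exists n. eauto.
Qed.

End Numbers.

Section Finite_sets.

Context {M : structure} (HZ : model M theory_Z).
Implicit Types a b c f g h i j k m n p r s u v w x y z X : M.

Lemma related_in r a b x y : Relation r a b -> Related r x y -> x ∈ a /\ y ∈ b.
Proof.
  intros Hr (p & Hp & Hpr). destruct (Hr p Hpr) as (x' & y' & Hx & Hy & Hp').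
  destruct (opair_inj p x y x' y') as [-> ->]; auto.
Qed.

Lemma finite_empty a : Empty a -> Finite a.
Proof.
  intros Ha. destruct (omega_exists HZ) as [w Hw].
  exists w, a. split; [assumption|].
  split; [now apply (zero_in_omega HZ w Hw)|].
  destruct (empty_exists HZ) as [f Hf]. exists f.
  split; [split|]; intros x Hx; exfalso; firstorder.
Qed.

Lemma finite_add a b x : Finite a -> ~ x ∈ a ->
  (forall y, y ∈ b <-> y ∈ a \/ y = x) -> Finite b.
Proof.
  intros (w & n & Hw & Hn & f & [Hf Hfun] & Hsurj) Hxa Hb.
  destruct (succ_exists HZ n) as [s Hs].
  destruct (relation_exists HZ (fun y i =>
    Related f y i \/ y = x /\ i = n)) with b s as (g & Hg & Hrel);
    [define_sets|].
  assert (Hdom := fun y i => related_in f a n y i Hf).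
  assert (Hnn := number_irreflexive HZ w Hw n Hn).
  exists w, s. split; [assumption|].
  split; [now apply (succ_in_omega HZ w Hw n)|].
  exists g. split; [split; [assumption|]|].
  - intros y [Hy| ->]%Hb.
    + destruct (Hfun y Hy) as (i & Hi & Huni). destruct (Hdom y i Hi).
      exists i. split.
      * apply Hrel. rewrite (Hb y), (Hs i). auto.
      * intros j (_ & _ & [Hj|[-> _]])%Hrel; [auto | contradiction].
    + exists n. split.
      * apply Hrel. rewrite (Hb x), (Hs n). auto.
      * intros j (_ & _ & [Hj|[_ ->]])%Hrel; [|reflexivity].
        now apply Hdom in Hj.
  - intros i [Hi| ->]%Hs.
    + destruct (Hsurj i Hi) as (y & Hy & Huni). destruct (Hdom y i Hy).
      exists y. split.
      * apply Hrel. rewrite (Hb y), (Hs i). auto.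
      * intros z (_ & _ & [Hz|[_ ->]])%Hrel; [auto | contradiction].
    + exists x. split.
      * apply Hrel. rewrite (Hb x), (Hs n). auto.
      * intros z (_ & _ & [Hz|[-> _]])%Hrel; [|reflexivity].
        apply Hdom in Hz. now destruct Hz.
Qed.

Variable w : M.
Hypothesis Hw : Omega w.

Lemma large_empty a : Empty a -> ~ large w a.
Proof.
  intros Ha H. destruct (empty_exists HZ) as [z Hz], (succ_exists HZ z) as [s Hs].
  destruct (H s) as (f & Htot & Hval & _).
  { apply (succ_in_omega HZ w Hw z); [|assumption].
    now apply (zero_in_omega HZ w Hw). }
  assert (Hzs : z ∈ s) by (apply Hs; auto).
  destruct (Htot z Hzs) as [y Hy]. exact (Ha y (Hval z y Hzs Hy)).
Qed.

(** The pigeonhole principle in one step: an injection of [n + 1] into [a ∪ {x}]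
    gives one of [n] into [a], by letting the argument that is sent to [x] take
    the value of [n] instead. *)
Lemma large_remove a b x :
  large w b -> (forall y, y ∈ b -> y ∈ a \/ y = x) -> large w a.
Proof.
  intros Hb Hba n Hn. destruct (succ_exists HZ n) as [s Hs].
  destruct (Hb s) as (h & Htot & Hval & Hfun & Hinj).
  { now apply (succ_in_omega HZ w Hw n). }
  assert (Hns : n ∈ s) by (apply Hs; auto).
  assert (Hsub : forall i, i ∈ n -> i ∈ s) by (intros i Hi; apply Hs; auto).
  assert (Hne : forall i, i ∈ n -> i <> n).
  { intros i Hi ->. exact (number_irreflexive HZ w Hw n Hn Hi). }
  destruct (Htot n Hns) as [v Hv].
  destruct (relation_exists HZ (fun i y =>
      Related h i y /\ y <> x \/ Related h i x /\ y = v)) with n a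
    as (f & _ & Hf); [define_sets|].
  assert (Hin : forall i y, i ∈ n ->
    Related h i y /\ y <> x \/ Related h i x /\ y = v -> y ∈ a).
  { intros i y Hi [[Hy Hyx]|[Hx ->]].
    - destruct (Hba y); [eauto | assumption | contradiction].
    - destruct (Hba v); [eauto | assumption|]. subst v.
      exfalso. apply (Hne i Hi). eauto. }
  exists f. split; [|split; [|split]].
  - intros i Hi. destruct (Htot i) as [y Hy]; [auto|].
    destruct (classic (y = x)) as [->|Hyx].
    + exists v. apply Hf. split; [assumption|]. split; eauto.
    + exists y. apply Hf. split; [assumption|]. split; eauto.
  - intros i y _ (_ & Hy & _)%Hf. assumption.
  - intros i y y' Hi (_ & _ & H)%Hf (_ & _ & H')%Hf.
    destruct H as [[Hy Hyx]|[Hy ->]], H' as [[Hy' Hyx']|[Hy' ->]]; eauto;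
      exfalso; [apply Hyx | apply Hyx']; eauto.
  - intros i j y Hi Hj (_ & _ & H)%Hf (_ & _ & H')%Hf.
    destruct H as [[Hy Hyx]|[Hy ->]], H' as [[Hy' Hyx']|[Hy' Hyv]]; eauto;
      exfalso; [apply (Hne i Hi) | apply (Hne j Hj)]; subst; eauto.
Qed.

(** An injection of [n] into [X] is not surjective, since [X] is infinite, and so
    it extends to [n + 1]. *)
Lemma infinite_large X : ~ Finite X -> large w X.
Proof.
  intros HX. unfold large. number_induction HZ Hw.
  - intros z Hz. exists z.
    split; [|split; [|split]]; intros i; intros; exfalso; firstorder.
  - intros n s Hn (f & Htot & Hval & Hfun & Hinj) Hs.
    assert (Hne : forall i, i ∈ n -> i <> n).
    { intros i Hi ->. exact (number_irreflexive HZ w Hw n Hn Hi). }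
    assert (exists x, x ∈ X /\ forall i, i ∈ n -> ~ Related f i x) as (x & Hx & Hnew).
    { apply NNPP. intros Hno. apply HX. exists w, n.
      split; [assumption|]. split; [assumption|].
      destruct (relation_exists HZ (fun x i => Related f i x)) with X n
        as (g & Hg & Hrel); [define_sets|].
      exists g. split; [split; [assumption|]|].
      - intros x Hx.
        assert (exists i, i ∈ n /\ Related f i x) as (i & Hi & Hix).
        { apply NNPP. intros Hno'. apply Hno. exists x. split; [assumption|].
          intros i Hi Hix. eauto. }
        exists i. split; [now apply Hrel|]. intros j (_ & Hj & Hjx)%Hrel. eauto.
      - intros i Hi. destruct (Htot i Hi) as [x Hx].
        exists x. split; [apply Hrel; eauto|]. intros y (_ & _ & Hy)%Hrel. eauto. }
    destruct (relation_exists HZ (fun i y =>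
        i ∈ n /\ Related f i y \/ i = n /\ y = x)) with s X
      as (g & _ & Hg); [define_sets|].
    exists g. split; [|split; [|split]].
    + intros i [Hi| ->]%Hs.
      * destruct (Htot i Hi) as [y Hy]. exists y. apply Hg. rewrite (Hs i).
        repeat split; eauto.
      * exists x. apply Hg. rewrite (Hs n). auto.
    + intros i y _ (_ & Hy & _)%Hg. assumption.
    + intros i y y' _ (_ & _ & H)%Hg (_ & _ & H')%Hg.
      destruct H as [[Hi Hy]|[-> ->]], H' as [[Hi' Hy']|[E ->]]; eauto;
        exfalso; [apply (Hne i Hi) | apply (Hne n Hi')]; auto.
    + intros i j y _ _ (_ & _ & H)%Hg (_ & _ & H')%Hg.
      destruct H as [[Hi Hy]|[Hi Hy]], H' as [[Hj Hy']|[Hj Hy']].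
      * now apply (Hinj i j y).
      * rewrite Hy' in Hy. now elim (Hnew i Hi).
      * rewrite Hy in Hy'. now elim (Hnew j Hj).
      * congruence.
Qed.

End Finite_sets.

(** Finiteness in the metatheory implies finiteness in the sense of the model,
    even where ω is non-standard. *)
Lemma finite_of_list {M : structure} (HZ : model M theory_Z) (l : list M) :
  forall X : M, (forall x, x ∈ X -> In x l) -> Finite X.
Proof.
  induction l as [|v l IH]; intros X HX.
  - apply (finite_empty HZ). intros x Hx. exact (HX x Hx).
  - destruct (separation HZ (fun x => x <> v)) with X as [Y HY]; [define|].
    assert (HYf : Finite Y).
    { apply IH. intros x [Hx Hxv]%HY. destruct (HX x Hx); [congruence | assumption]. }
    destruct (classic (v ∈ X)) as [Hv|Hv].
    + apply (finite_add HZ Y X v HYf).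
      * now intros [_ H]%HY.
      * intros y. rewrite (HY y). split; [|intros [H| ->]; tauto].
        destruct (classic (y = v)); auto.
    + replace X with Y; [assumption|]. apply (extensionality HZ). intros y.
      rewrite (HY y). split; [tauto|]. intros Hy. split; [assumption|].
      now intros ->.
Qed.

(** * From a sequence of injections to Dedekind infinity *)

Section Sequence_of_injections.

Context {M : structure} (HZ : model M theory_Z).
Implicit Types a b c f i j k m n s u x y z : M.
Variables w X F : M.
Hypothesis Hw : Omega w.

(** The [n]-th value of the choice function [F] is an injection of [n] into [X],
    read here as a sequence of length [n] without repetitions. *)
Definition entry n i y : Prop := exists f, Related F n f /\ Related f i y.

Hypothesis HF : forall n, n ∈ w -> exists f, injects f n X /\
  forall i y, entry n i y <-> Related f i y.

Definition seen m y : Prop := exists n i, n ∈ m /\ i ∈ n /\ entry n i y.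

Ltac define_seq := unfold seen, entry; define_sets.

Lemma seen_succ m s y : Succ s m ->
  seen s y <-> seen m y \/ exists i, i ∈ m /\ entry m i y.
Proof.
  intros Hs. split.
  - intros (n & i & [Hn| ->]%Hs & Hi & Hy); [left; now exists n, i | eauto].
  - intros [(n & i & Hn & Hi & Hy)|(i & Hi & Hy)].
    + exists n, i. rewrite (Hs n). auto.
    + exists m, i. rewrite (Hs m). auto.
Qed.

Lemma entry_in n i y : n ∈ w -> i ∈ n -> entry n i y -> y ∈ X.
Proof.
  intros Hn Hi Hy. destruct (HF n Hn) as (f & (_ & Hval & _) & Hf).
  apply Hf in Hy. eauto.
Qed.

Lemma entry_functional n i y z :
  n ∈ w -> i ∈ n -> entry n i y -> entry n i z -> y = z.
Proof.
  intros Hn Hi Hy Hz. destruct (HF n Hn) as (f & (_ & _ & Hfun & _) & Hf).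
  apply Hf in Hy, Hz. eauto.
Qed.

(** By induction on [m], and within the step by induction on the length of the
    [m]-th sequence: a non-large set stays so when one element is added. *)
Lemma seen_not_large m : m ∈ w ->
  forall a, (forall y, y ∈ a -> seen m y) -> ~ large w a.
Proof.
  revert m. number_induction HZ Hw; [define_seq| |].
  - intros z Hz a Ha. apply (large_empty HZ w Hw). intros y Hy.
    destruct (Ha y Hy) as (n & i & Hn & _). exact (Hz n Hn).
  - intros m s Hm IH Hs.
    assert (H : forall k, k ∈ w -> forall a,
      (forall y, y ∈ a -> seen m y \/ exists i, i ∈ k /\ i ∈ m /\ entry m i y) ->
      ~ large w a).
    { number_induction HZ Hw; [define_seq| |].
      - intros z Hz a Ha. apply IH. intros y Hy.
        destruct (Ha y Hy) as [|(i & Hi & _)]; [assumption|].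
        exfalso. exact (Hz i Hi).
      - intros k t Hk IHk Ht a Ha Hlarge.
        destruct (classic (k ∈ m)) as [Hkm|Hkm].
        + destruct (HF m Hm) as (f & (Htot & _) & Hf).
          destruct (Htot k Hkm) as [v Hv%Hf].
          destruct (separation HZ (fun y => y <> v)) with a as [a' Ha'];
            [define|].
          apply (IHk a').
          * intros y [Hy Hyv]%Ha'. destruct (Ha y Hy) as [|(i & Hi & Him & Hiy)];
              [auto|].
            right. exists i. apply Ht in Hi as [Hi| ->]; [auto|].
            exfalso. apply Hyv. now apply (entry_functional m k).
          * apply (large_remove HZ w Hw a' a v Hlarge). intros y Hy.
            rewrite (Ha' y). destruct (classic (y = v)); auto.
        + apply (IHk a); [|assumption]. intros y Hy.
          destruct (Ha y Hy) as [|(i & Hi & Him & Hiy)]; [auto|].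
          right. exists i. apply Ht in Hi as [Hi| ->]; [auto | contradiction]. }
    intros a Ha. apply (H m Hm). intros y Hy.
    apply Ha, (seen_succ m s y Hs) in Hy as [Hy|(i & Hi & Hy)]; eauto.
Qed.

Definition contributing m : Prop :=
  m ∈ w /\ exists i y, i ∈ m /\ entry m i y /\ ~ seen m y.

(** If all contributing indices were in [m], every entry would occur in a
    sequence with index in [m]; the set of these entries would then be large, as
    it receives all the sequences. *)
Lemma contributing_unbounded m :
  m ∈ w -> exists c, contributing c /\ ~ c ∈ m.
Proof.
  intros Hm. apply NNPP. intros Hno.
  assert (H : forall n, n ∈ w -> forall y, seen n y -> seen m y).
  { number_induction HZ Hw; [define_seq| |].
    - intros z Hz y (n & i & Hn & _). exfalso. exact (Hz n Hn).
    - intros n s Hn IH Hs y [Hy|(i & Hi & Hy)]%(seen_succ n s y Hs); [auto|].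
      destruct (classic (n ∈ m)) as [Hnm|Hnm]; [now exists n, i|].
      apply IH, NNPP. intros HU. apply Hno. exists n.
      split; [|assumption]. split; [assumption|]. now exists i, y. }
  destruct (separation HZ (fun y => seen m y)) with X as [a Ha]; [define_seq|].
  apply (seen_not_large m Hm a).
  { intros y Hy. now apply Ha in Hy. }
  intros n Hn. destruct (HF n Hn) as (f & (Htot & Hval & Hfun & Hinj) & Hf).
  exists f. split; [assumption|]. split; [|now split].
  intros i y Hi Hy. apply Ha. split; [eauto|].
  destruct (succ_exists HZ n) as [s Hs].
  apply (H s).
  - now apply (succ_in_omega HZ w Hw n).
  - apply (seen_succ n s y Hs). right. exists i. split; [assumption|]. now apply Hf.
Qed.

Definition first_new m x : Prop :=
  contributing m /\ exists i, i ∈ m /\ entry m i x /\ ~ seen m x /\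
    forall j y, j ∈ i -> entry m j y -> seen m y.

Lemma first_new_exists m : contributing m -> exists x, first_new m x.
Proof.
  intros [Hm (i & y & Hi & Hy & HU)].
  destruct (omega_least HZ w Hw (fun i => i ∈ m /\ exists y, entry m i y /\ ~ seen m y) i)
    as (k & Hk & (Hkm & x & Hx & HUx) & Hmin).
  - define_seq.
  - exact (omega_transitive HZ w Hw m Hm i Hi).
  - eauto.
  - exists x. split; [split; eauto|]. exists k.
    split; [assumption|]. split; [assumption|]. split; [assumption|].
    intros j z Hj Hz. apply NNPP. intros HUz. apply (Hmin j Hj).
    split; [|eauto]. exact (number_transitive HZ w Hw m Hm k j Hj Hkm).
Qed.

Lemma first_new_functional m x y : first_new m x -> first_new m y -> x = y.
Proof.
  intros [[Hm _] (i & Hi & Hx & HUx & Hmini)] [_ (j & Hj & Hy & HUy & Hminj)].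
  assert (Hiw := omega_transitive HZ w Hw m Hm i Hi).
  assert (Hjw := omega_transitive HZ w Hw m Hm j Hj).
  destruct (number_trichotomy HZ w Hw i j Hiw Hjw) as [H|[->|H]].
  - elim HUx. eauto.
  - now apply (entry_functional m j).
  - elim HUy. eauto.
Qed.

Lemma first_new_injective m n x : first_new m x -> first_new n x -> m = n.
Proof.
  intros [[Hm _] (i & Hi & Hx & HUx & _)] [[Hn _] (j & Hj & Hy & HUy & _)].
  destruct (number_trichotomy HZ w Hw m n Hm Hn) as [H|[H|H]];
    [elim HUy; now exists m, i | assumption | elim HUx; now exists n, j].
Qed.

Lemma first_new_in m x : first_new m x -> x ∈ X.
Proof.
  intros [[Hm _] (i & Hi & Hx & _)]. now apply (entry_in m i).
Qed.

(** Contributing indices, unlike first new elements, are linearly ordered by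
    membership; taking successors in this order replaces a definition by
    recursion. *)
Definition next_contributing m n : Prop :=
  contributing m /\ contributing n /\ m ∈ n /\ forall c, contributing c -> m ∈ c -> ~ c ∈ n.

Lemma next_contributing_exists m :
  contributing m -> exists n, next_contributing m n.
Proof.
  intros HC. assert (Hm := proj1 HC).
  destruct (succ_exists HZ m) as [s Hs].
  destruct (contributing_unbounded s) as (c & Hc & Hcs).
  { now apply (succ_in_omega HZ w Hw m). }
  assert (Hmc : m ∈ c).
  { rewrite (Hs c) in Hcs.
    destruct (number_trichotomy HZ w Hw m c Hm (proj1 Hc)) as [|[->|]]; tauto. }
  destruct (omega_least HZ w Hw (fun c => contributing c /\ m ∈ c) c)
    as (n & Hn & [HCn Hmn] & Hmin); [|apply Hc | auto |].
  - unfold contributing. define_seq.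
  - exists n. repeat split; try apply HC; try apply HCn; auto.
    intros k Hk Hmk Hkn. now apply (Hmin k).
Qed.

Lemma next_contributing_functional m n k :
  next_contributing m n -> next_contributing m k -> n = k.
Proof.
  intros (Hm & Hn & Hmn & H) (_ & Hk & Hmk & H').
  destruct (number_trichotomy HZ w Hw n k (proj1 Hn) (proj1 Hk)) as [E|[E|E]];
    [elim (H' n); auto | assumption | elim (H k); auto].
Qed.

Lemma next_contributing_injective m n k :
  next_contributing m k -> next_contributing n k -> m = n.
Proof.
  intros (Hm & Hk & Hmk & H) (Hn & _ & Hnk & H').
  destruct (number_trichotomy HZ w Hw m n (proj1 Hm) (proj1 Hn)) as [E|[E|E]];
    [elim (H n); auto | assumption | elim (H' m); auto].
Qed.

(** The point missed by the shift is the first new element at the least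
    contributing index. *)
Lemma sequence_dedekind_infinite : Dedekind_infinite X.
Proof.
  destruct (relation_exists HZ (fun x y =>
      (exists m n, first_new m x /\ next_contributing m n /\ first_new n y) \/
      (forall m, ~ first_new m x) /\ x = y)) with X X as (r & _ & Hr).
  { unfold next_contributing, first_new, contributing. define_seq. }
  destruct (empty_exists HZ) as [o Ho].
  destruct (contributing_unbounded o) as (c & Hc & _); [now apply (zero_in_omega HZ w Hw)|].
  destruct (omega_least HZ w Hw contributing c) as (c0 & _ & Hc0 & Hmin);
    [unfold contributing; define_seq | apply Hc | assumption|].
  destruct (first_new_exists c0 Hc0) as [z Hz].
  apply (injection_dedekind_infinite HZ X r z).
  - intros x Hx. destruct (classic (exists m, first_new m x)) as [[m Hm]|Hno].
    + destruct (next_contributing_exists m (proj1 Hm)) as [n Hn].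
      destruct (first_new_exists n) as [y Hy]; [apply Hn|].
      exists y. assert (y ∈ X) by now apply (first_new_in n).
      split; [assumption|]. apply Hr. split; [assumption|].
      split; [assumption|]. left. now exists m, n.
    + exists x. split; [assumption|]. apply Hr. split; [assumption|].
      split; [assumption|]. right. split; [|reflexivity].
      intros m Hm. eauto.
  - intros x y y' (_ & _ & H)%Hr (_ & _ & H')%Hr.
    destruct H as [(m & n & Hm & Hn & Hy)|[Hno Hy]],
      H' as [(m' & n' & Hm' & Hn' & Hy')|[Hno' Hy']].
    + rewrite (first_new_injective m' m x Hm' Hm) in Hn'.
      rewrite (next_contributing_functional m n' n Hn' Hn) in Hy'.
      now apply (first_new_functional n).
    + elim (Hno' m Hm).
    + elim (Hno m' Hm').
    + congruence.
  - intros x x' y (_ & _ & H)%Hr (_ & _ & H')%Hr.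
    destruct H as [(m & n & Hm & Hn & Hy)|[Hno Hy]],
      H' as [(m' & n' & Hm' & Hn' & Hy')|[Hno' Hy']].
    + rewrite (first_new_injective n' n y Hy' Hy) in Hn'.
      rewrite (next_contributing_injective m' m n Hn' Hn) in Hm'.
      now apply (first_new_functional m).
    + elim (Hno' n). now rewrite Hy'.
    + elim (Hno n'). now rewrite Hy.
    + congruence.
  - now apply (first_new_in c0).
  - intros x _ (_ & _ & [(m & n & Hm & Hn & Hzn)|[Hno ->]])%Hr; [|exact (Hno c0 Hz)].
    rewrite (first_new_injective n c0 z Hzn Hz) in Hn.
    destruct Hn as (Hm' & _ & Hmc & _). exact (Hmin m Hmc Hm').
Qed.

End Sequence_of_injections.

(** * Countable choice implies SD *)

Lemma choice_infinite_dedekind_infinite (M : structure) (HZ : model M theory_Z) :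
  @Countable_choice M ->
  forall X : M, ~ Finite X -> Dedekind_infinite X.
Proof.
  intros HAC X HX. destruct (omega_exists HZ) as [w Hw].
  destruct (opairs_bounded HZ w X) as [c Hc], (power_exists HZ c) as [b Hb].
  destruct (relation_exists HZ (fun n f => injects f n X)) with w b
    as (r & Hr & Hrel); [define_sets|].
  destruct (HAC w b r Hw Hr) as (F & [HF HFun] & HFr).
  { intros n Hn. destruct (infinite_large HZ w Hw X HX n Hn)
      as (f & Htot & Hval & Hfun & Hinj).
    destruct (relation_exists HZ (fun i y => Related f i y)) with n X
      as (g & Hg & Hgf); [define_sets|].
    exists g. assert (Hgb : g ∈ b).
    { apply Hb. intros p (i & y & Hi & Hy & Hp)%Hg.
      apply (Hc i y p); auto. exact (omega_transitive HZ w Hw n Hn i Hi). }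
    split; [assumption|]. apply Hrel. split; [assumption|].
    split; [assumption|]. split; [|split; [|split]].
    - intros i Hi. destruct (Htot i Hi) as [y Hy]. exists y. apply Hgf. eauto.
    - intros i y _ (_ & Hy & _)%Hgf. assumption.
    - intros i y z Hi (_ & _ & Hy)%Hgf (_ & _ & Hz)%Hgf. eauto.
    - intros i j y Hi Hj (_ & _ & Hy)%Hgf (_ & _ & Hz)%Hgf. eauto. }
  apply (sequence_dedekind_infinite HZ w X F Hw).
  intros n Hn. destruct (HFr n Hn) as (f & Hf & (_ & _ & Hinj)%Hrel).
  exists f. split; [assumption|]. intros i y. split; [|now exists f].
  intros (f' & Hf' & Hy). destruct (HFun n Hn) as (f0 & _ & Huni).
  now rewrite (Huni f Hf), <- (Huni f' Hf').
Qed.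

Lemma theory_Z_closed A : theory_Z A -> bounded 0 A.
Proof.
  assert (Hiter : forall B k m, bounded (k + m) B -> bounded m (Nat.iter k All B)).
  { intros B k. induction k as [|k IH]; intros m HB; [assumption|].
    cbn. apply IH. now rewrite Nat.add_succ_r. }
  intros []; try (cbn; lia).
  apply Hiter. rewrite Nat.add_0_r. cbn. repeat split; try lia;
    (eapply bounded_rename; [|eassumption]); intros [|i]; simpl; lia.
Qed.

Lemma Z_choice_proves_SD : provable (extend theory_Z AC_aleph0) SD.
Proof.
  apply completeness.
  - intros B [HB| ->]; [now apply theory_Z_closed | cbn; lia].
  - intros M HM. apply holds_SD, choice_infinite_dedekind_infinite.
    + intros A HA. apply HM. now left.
    + apply holds_AC, HM. now right.
Qed.

(** * Translations *)

Definition translation : Type := nat -> Qc.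

Definition vanishes (n : nat) (s : translation) : Prop :=
  forall j, j < n -> s j = 0%Qc.

Definition add (s t : translation) : translation := fun j => (s j + t j)%Qc.
Definition opp (s : translation) : translation := fun j => (- s j)%Qc.
Definition zero : translation := fun _ => 0%Qc.

Lemma vanishes_opp n s : vanishes n s -> vanishes n (opp s).
Proof.
  intros H j Hj. unfold opp. now rewrite H.
Qed.

Lemma vanishes_mono m n s : m <= n -> vanishes n s -> vanishes m s.
Proof.
  intros Hmn H j Hj. apply H. lia.
Qed.

Lemma add_comm s t : add s t = add t s.
Proof. apply functional_extensionality. intros j. unfold add. ring. Qed.

Lemma add_opp s : add (opp s) s = zero.
Proof. apply functional_extensionality. intros j. unfold add, opp, zero. ring. Qed.

(** * Trees over self-membered atoms *)

(** Terms for sets: extensionality, and the equation [a = {a}] for atoms, are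
    imposed by [eqv]. *)
Inductive tree : Type :=
| atom (n : nat) (q : Qc)
| node (X : Type) (f : X -> tree).

Definition index (x : tree) : Type :=
  match x with atom _ _ => unit | node X _ => X end.

Definition elt (x : tree) : index x -> tree :=
  match x with atom n q => fun _ => atom n q | node _ f => f end.

(** An atom equals its singleton, hence every tree built over that atom alone
    without empty nodes. *)
Fixpoint is_atom (n : nat) (q : Qc) (x : tree) : Prop :=
  match x with
  | atom m r => m = n /\ r = q
  | node X f => inhabited X /\ forall i, is_atom n q (f i)
  end.

Fixpoint eqv (x y : tree) : Prop :=
  match x, y with
  | atom n q, _ => is_atom n q y
  | node _ _, atom n q => is_atom n q x
  | node _ f, node _ g =>
      (forall i, exists j, eqv (f i) (g j)) /\
      (forall j, exists i, eqv (f i) (g j))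
  end.

Lemma eqv_refl x : eqv x x.
Proof.
  induction x as [n q|X f IH]; simpl; eauto.
Qed.

Lemma eqv_sym x : forall y, eqv x y -> eqv y x.
Proof.
  induction x as [n q|X f IH]; intros [m r|Y g]; simpl; auto.
  - intuition congruence.
  - intros [H1 H2]. split.
    + intros j. destruct (H2 j) as [i Hi]. eauto.
    + intros i. destruct (H1 i) as [j Hj]. eauto.
Qed.

Lemma is_atom_eqv n q x : forall y, is_atom n q x -> is_atom n q y -> eqv x y.
Proof.
  induction x as [m r|X f IH].
  - now intros y [-> ->].
  - intros [k p|Y g]; simpl; intros [[i0] Hf].
    + intros [-> ->]. split; [now constructor | assumption].
    + intros [[j0] Hg]. split; [intros i; exists j0 | intros j; exists i0]; auto.
Qed.

Lemma is_atom_unique n q m r x :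
  is_atom n q x -> is_atom m r x -> n = m /\ q = r.
Proof.
  induction x as [k p|X f IH]; simpl.
  - intuition congruence.
  - intros [[i] H] [_ H']. exact (IH i (H i) (H' i)).
Qed.

Lemma eqv_is_atom n q x : forall y, is_atom n q x -> eqv x y -> is_atom n q y.
Proof.
  induction x as [m r|X f IH].
  - now intros y [-> ->].
  - intros [k p|Y g] Hx Hxy.
    + now destruct (is_atom_unique k p n q _ Hxy Hx).
    + destruct Hx as [[i0] Hx], Hxy as [H1 H2]. split.
      * destruct (H1 i0) as [j _]. now constructor.
      * intros j. destruct (H2 j) as [i Hi]. eauto.
Qed.

Lemma eqv_trans x : forall y z, eqv x y -> eqv y z -> eqv x z.
Proof.
  induction x as [n q|X f IH].
  - intros y z. apply eqv_is_atom.
  - intros [m r|Y g] z Hxy Hyz; [exact (is_atom_eqv m r _ _ Hxy Hyz)|].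
    destruct z as [k p|Z h].
    + exact (eqv_is_atom k p _ _ Hyz (eqv_sym _ _ Hxy)).
    + destruct Hxy as [H1 H2], Hyz as [H3 H4]. split.
      * intros i. destruct (H1 i) as [j Hj], (H3 j) as [k Hk]. eauto.
      * intros k. destruct (H4 k) as [j Hj], (H2 j) as [i Hi]. eauto.
Qed.

(** Extensionality: in the cases that involve an atom it expresses that the atom
    and its singleton are equal. *)
Lemma eqv_elements x y : eqv x y <->
  (forall i, exists j, eqv (elt x i) (elt y j)) /\
  (forall j, exists i, eqv (elt x i) (elt y j)).
Proof.
  destruct x as [n q|X f], y as [m r|Y g]; simpl.
  - split; [split; intros []; exists tt; auto|].
    intros [H _]. now destruct (H tt).
  - split.
    + intros [[j] H]. split; [intros []; exists j; apply H | intros k; exists tt; apply H].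
    + intros [H1 H2]. destruct (H1 tt) as [j _].
      split; [now constructor|]. intros k. now destruct (H2 k).
  - assert (Hs : forall i, eqv (f i) (atom m r) <-> is_atom m r (f i)).
    { intros i. split; [apply (eqv_sym (f i) (atom m r))|].
      apply (eqv_sym (atom m r)). }
    split.
    + intros [[i] H].
      split; [intros k; exists tt | intros []; exists i]; apply Hs, H.
    + intros [H1 H2]. destruct (H2 tt) as [i _].
      split; [now constructor|]. intros k. destruct (H1 k) as [_ Hk].
      now apply Hs.
  - reflexivity.
Qed.

Definition tree_mem (x y : tree) : Prop := exists i, eqv x (elt y i).

Lemma tree_mem_eqv x x' y y' :
  eqv x x' -> eqv y y' -> tree_mem x y -> tree_mem x' y'.
Proof.
  intros Hx Hy [i Hi]. apply eqv_elements in Hy as [Hy _].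
  destruct (Hy i) as [j Hj]. exists j.
  eapply eqv_trans; [apply eqv_sym, Hx|]. eapply eqv_trans; eassumption.
Qed.

Fixpoint translate (s : translation) (x : tree) : tree :=
  match x with
  | atom n q => atom n (q + s n)%Qc
  | node X f => node X (fun i => translate s (f i))
  end.

Lemma translate_is_atom s n q x :
  is_atom n q x -> is_atom n (q + s n)%Qc (translate s x).
Proof.
  induction x as [m r|X f IH]; simpl.
  - now intros [-> ->].
  - intros [Hi H]. auto.
Qed.

Lemma translate_eqv s x : forall y,
  eqv x y -> eqv (translate s x) (translate s y).
Proof.
  induction x as [n q|X f IH].
  - intros y. apply translate_is_atom.
  - intros [m r|Y g] H.
    + exact (translate_is_atom s m r _ H).
    + destruct H as [H1 H2]. split.
      * intros i. destruct (H1 i) as [j Hj]. exists j. now apply IH.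
      * intros j. destruct (H2 j) as [i Hi]. exists i. now apply IH.
Qed.

Lemma translate_mem s x y :
  tree_mem x y -> tree_mem (translate s x) (translate s y).
Proof.
  intros [i Hi]. apply (translate_eqv s) in Hi.
  destruct y as [n q|X f]; [now exists tt | now exists i].
Qed.

Lemma translate_zero x : translate zero x = x.
Proof.
  induction x as [n q|X f IH]; simpl; f_equal.
  - apply Qcplus_0_r.
  - now apply functional_extensionality.
Qed.

Lemma translate_add s t x : translate s (translate t x) = translate (add s t) x.
Proof.
  induction x as [n q|X f IH]; simpl; f_equal.
  - unfold add. ring.
  - now apply functional_extensionality.
Qed.

(** * Hereditarily symmetric trees *)

Definition tree_supported (n : nat) (x : tree) : Prop :=
  forall s, vanishes n s -> eqv (translate s x) x.

Fixpoint symmetric (x : tree) : Prop :=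
  match x with
  | atom _ _ => True
  | node X f => (exists n, tree_supported n (node X f)) /\ forall i, symmetric (f i)
  end.

Lemma symmetric_supported x : symmetric x -> exists n, tree_supported n x.
Proof.
  destruct x as [n q|X f]; [|now intros []].
  exists (S n). intros s Hs. simpl. rewrite Hs by lia.
  split; [reflexivity | symmetry; apply Qcplus_0_r].
Qed.

Lemma symmetric_element x : symmetric x -> forall i, symmetric (elt x i).
Proof.
  destruct x as [n q|X f]; [easy | now intros []].
Qed.

(** This is where commutativity of the group enters: a tree and its translates
    have the same supports. *)
Lemma translate_symmetric s x : symmetric x -> symmetric (translate s x).
Proof.
  induction x as [n q|X f IH]; [easy|]. intros [[n Hn] Hf]. split; [|now auto].
  exists n. intros t Ht.
  change (eqv (translate t (translate s (node X f))) (translate s (node X f))).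
  rewrite translate_add, add_comm, <- translate_add. now apply translate_eqv, Hn.
Qed.

Definition symmetric_tree : Type := {x : tree | symmetric x}.

Definition tree_eq (x y : symmetric_tree) : Prop :=
  eqv (proj1_sig x) (proj1_sig y).

Definition to_set : symmetric_tree -> quotient tree_eq := class_of tree_eq.

Lemma to_set_eq x y : to_set x = to_set y <-> tree_eq x y.
Proof.
  apply class_of_eq; unfold tree_eq;
    eauto using eqv_refl, eqv_sym, eqv_trans.
Qed.

(** * The permutation model *)

Definition permutation_model : structure := {|
  carrier := quotient tree_eq;
  mem a b := exists x y, a = to_set x /\ b = to_set y /\
    tree_mem (proj1_sig x) (proj1_sig y);
  carrier_nonempty := inhabits (to_set (exist symmetric (atom 0 0%Qc) I))
|}.

Notation PM := permutation_model.

Lemma to_set_surj (a : PM) : exists x, a = to_set x.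
Proof. apply class_of_surj. Qed.

Lemma to_set_mem x y : mem PM (to_set x) (to_set y) <->
  tree_mem (proj1_sig x) (proj1_sig y).
Proof.
  split; [|now exists x, y].
  intros (x' & y' & Hx%to_set_eq & Hy%to_set_eq & H). revert H.
  apply tree_mem_eqv; now apply eqv_sym.
Qed.

Lemma PM_extensionality (a b : PM) : (forall z, z ∈ a <-> z ∈ b) -> a = b.
Proof.
  destruct (to_set_surj a) as [[x Hx] ->], (to_set_surj b) as [[y Hy] ->].
  intros H. apply to_set_eq, eqv_elements. cbn [proj1_sig]. split.
  - intros i.
    apply (to_set_mem (exist _ _ (symmetric_element x Hx i)) (exist _ y Hy)), H,
      to_set_mem. exists i. apply eqv_refl.
  - intros j.
    destruct (proj1 (to_set_mem (exist _ _ (symmetric_element y Hy j)) (exist _ x Hx)))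
      as [i Hi].
    + apply H, to_set_mem. exists j. apply eqv_refl.
    + exists i. now apply eqv_sym.
Qed.

Lemma PM_elements (a : PM) :
  {X : Type & {f : X -> PM | forall z, z ∈ a <-> exists i, z = f i}}.
Proof.
  destruct (constructive_indefinite_description _ (to_set_surj a)) as [[x Hx] ->].
  exists (index x), (fun i => to_set (exist _ _ (symmetric_element x Hx i))).
  intros z. destruct (to_set_surj z) as [y ->]. rewrite to_set_mem.
  split; intros [i Hi]; exists i; [apply to_set_eq, Hi|].
  exact (proj1 (to_set_eq _ _) Hi).
Qed.

Definition act (s : translation) (a : PM) : PM :=
  let x := proj1_sig (constructive_indefinite_description _ (to_set_surj a)) in
  to_set (exist _ _ (translate_symmetric s _ (proj2_sig x))).

Lemma act_to_set s x Hx :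
  act s (to_set (exist _ x Hx)) = to_set (exist _ _ (translate_symmetric s x Hx)).
Proof.
  apply to_set_eq. unfold tree_eq. cbn [proj1_sig].
  apply translate_eqv, eqv_sym.
  exact (proj1 (to_set_eq _ _) (proj2_sig (constructive_indefinite_description _
    (to_set_surj (to_set (exist _ x Hx)))))).
Qed.

Lemma act_zero a : act zero a = a.
Proof.
  destruct (to_set_surj a) as [[x Hx] ->]. rewrite act_to_set.
  apply to_set_eq. unfold tree_eq. simpl. rewrite translate_zero. apply eqv_refl.
Qed.

Lemma act_add s t a : act s (act t a) = act (add s t) a.
Proof.
  destruct (to_set_surj a) as [[x Hx] ->]. rewrite !act_to_set.
  apply to_set_eq. unfold tree_eq. simpl. rewrite translate_add. apply eqv_refl.
Qed.

Lemma act_comm s t a : act s (act t a) = act t (act s a).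
Proof. now rewrite !act_add, add_comm. Qed.

Lemma act_opp s a : act (opp s) (act s a) = a.
Proof. now rewrite act_add, add_opp, act_zero. Qed.

Lemma act_inverse s a : act s (act (opp s) a) = a.
Proof. now rewrite act_comm, act_opp. Qed.

Lemma act_mem s a b : act s a ∈ act s b <-> a ∈ b.
Proof.
  assert (H : forall s a b, a ∈ b -> act s a ∈ act s b).
  { clear. intros s a b.
    destruct (to_set_surj a) as [[x Hx] ->], (to_set_surj b) as [[y Hy] ->].
    rewrite !act_to_set, !to_set_mem. apply translate_mem. }
  split; [|apply H]. intros Hab%(H (opp s)). now rewrite !act_opp in Hab.
Qed.

Lemma act_injective s a b : act s a = act s b -> a = b.
Proof.
  intros H%(f_equal (act (opp s))). now rewrite !act_opp in H.
Qed.

(** Translations are automorphisms of the model, so that definable predicates are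
    invariant under those that fix the parameters. *)
Lemma act_sat s A : forall e : nat -> PM,
  sat PM (fun i => act s (e i)) A <-> sat PM e A.
Proof.
  induction A as [|x y|x y|A IHA B IHB|A IH]; cbn [sat]; intros e.
  - reflexivity.
  - split; [apply act_injective | congruence].
  - apply act_mem.
  - now rewrite IHA, IHB.
  - assert (H : forall a, sat PM (scons (act s a) (fun i => act s (e i))) A <->
                sat PM (scons a e) A).
    { intros a. rewrite <- (IH (scons a e)). apply sat_ext. now intros [|i]. }
    split; intros HA a; [now apply H|].
    rewrite <- (act_inverse s a). now apply H.
Qed.

Definition supported (n : nat) (a : PM) : Prop :=
  forall s, vanishes n s -> act s a = a.

Lemma supported_exists a : exists n, supported n a.
Proof.
  destruct (to_set_surj a) as [[x Hx] ->].
  destruct (symmetric_supported x Hx) as [n Hn]. exists n.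
  intros s Hs. rewrite act_to_set. apply to_set_eq. now apply Hn.
Qed.

Lemma supported_mono m n a : m <= n -> supported m a -> supported n a.
Proof.
  intros Hmn H s Hs. apply H. eapply vanishes_mono; eassumption.
Qed.

Lemma supported_act n s a : supported n a -> supported n (act s a).
Proof.
  intros H t Ht. now rewrite act_comm, H.
Qed.

Lemma supported_mem n s a x :
  supported n a -> vanishes n s -> x ∈ a -> act s x ∈ a.
Proof.
  intros Ha Hs Hx. rewrite <- (Ha s Hs). now apply act_mem.
Qed.

(** The source of all sets of the model: a family indexed by a small type is a set
    as soon as some [n] supports its range. *)
Lemma collect (X : Type) (f : X -> PM) n :
  (forall s i, vanishes n s -> exists j, act s (f i) = f j) ->
  exists a, forall z, z ∈ a <-> exists i, z = f i.
Proof.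
  intros Hf.
  destruct (choice (fun i x => f i = to_set x)) as [g Hg].
  { intros i. apply to_set_surj. }
  set (x := node X (fun i => proj1_sig (g i))).
  assert (Hact : forall s i, vanishes n s -> exists j,
    eqv (translate s (proj1_sig (g i))) (proj1_sig (g j))).
  { intros s i Hs. destruct (Hf s i Hs) as [j Hj]. exists j.
    rewrite !Hg in Hj. destruct (g i) as [y Hy]. rewrite act_to_set in Hj.
    now apply to_set_eq in Hj. }
  assert (Hx : symmetric x).
  { split; [|intros i; exact (proj2_sig (g i))].
    exists n. intros s Hs. split; [intros i; now apply Hact|].
    intros j. destruct (Hact (opp s) j) as [i Hi]; [now apply vanishes_opp|].
    exists i. apply (translate_eqv s), eqv_sym in Hi.
    now rewrite translate_add, add_comm, add_opp, translate_zero in Hi. }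
  exists (to_set (exist _ x Hx)). intros z.
  destruct (to_set_surj z) as [y ->]. rewrite to_set_mem.
  split; intros [i Hi]; exists i.
  - rewrite Hg. apply to_set_eq, Hi.
  - rewrite Hg in Hi. exact (proj1 (to_set_eq _ _) Hi).
Qed.

Definition set_atom (n : nat) (q : Qc) : PM := to_set (exist symmetric (atom n q) I).

Lemma act_atom s n q : act s (set_atom n q) = set_atom n (q + s n)%Qc.
Proof.
  unfold set_atom. rewrite act_to_set. now apply to_set_eq.
Qed.

Lemma set_atom_inj n m q r : set_atom n q = set_atom m r -> n = m /\ q = r.
Proof.
  intros [H1 H2]%to_set_eq. now split; symmetry.
Qed.

Lemma symmetric_separation (P : PM -> Prop) n :
  (forall s x, vanishes n s -> P x -> P (act s x)) ->
  forall a, exists b, forall x, x ∈ b <-> x ∈ a /\ P x.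
Proof.
  intros HP a. destruct (PM_elements a) as (X & f & Hf).
  destruct (supported_exists a) as [m Hm].
  destruct (collect {i : X | P (f i)} (fun i => f (proj1_sig i)) (max m n))
    as [b Hb].
  - intros s [i Hi] Hs. simpl.
    assert (H : act s (f i) ∈ a).
    { apply (supported_mem m); [assumption| |apply Hf; now exists i].
      apply (vanishes_mono m (max m n)); [lia | assumption]. }
    apply Hf in H as [j Hj].
    assert (HPj : P (f j)).
    { rewrite <- Hj. apply HP; [|assumption].
      apply (vanishes_mono n (max m n)); [lia | assumption]. }
    now exists (exist _ j HPj).
  - exists b. intros x. rewrite (Hb x), (Hf x). split.
    + intros [[i Hi] ->]. simpl. eauto.
    + intros [[i ->] Hi]. now exists (exist _ i Hi).
Qed.

(** * The permutation model satisfies Z *)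

Lemma PM_empty : exists a : PM, Empty a.
Proof.
  destruct (collect False (fun i => match i with end) 0) as [a Ha].
  - intros s [].
  - exists a. intros x [[] _]%Ha.
Qed.

Lemma PM_pair (a b : PM) : exists p, Pair p a b.
Proof.
  destruct (supported_exists a) as [m Hm], (supported_exists b) as [n Hn].
  destruct (collect bool (fun i => if i then a else b) (max m n)) as [p Hp].
  - intros s i Hs. exists i. destruct i; [apply Hm | apply Hn];
      (eapply vanishes_mono; [|exact Hs]; lia).
  - exists p. intros x. rewrite (Hp x). split.
    + intros [[] ->]; auto.
    + intros [->| ->]; [now exists true | now exists false].
Qed.

Lemma PM_union (a : PM) : exists u, Union u a.
Proof.
  destruct (supported_exists a) as [n Hn].
  destruct (PM_elements a) as (X & f & Hf).
  set (Y b := projT1 (PM_elements b)).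
  set (g b := proj1_sig (projT2 (PM_elements b))).
  assert (Hg : forall b z, z ∈ b <-> exists i, z = g b i).
  { intros b. exact (proj2_sig (projT2 (PM_elements b))). }
  destruct (collect {i : X & Y (f i)} (fun k => g (f (projT1 k)) (projT2 k)) n)
    as [u Hu].
  - intros s [i j] Hs. simpl.
    assert (H : act s (f i) ∈ a).
    { apply (supported_mem n); [assumption..|]. apply Hf. now exists i. }
    apply Hf in H as [i' Hi'].
    assert (H : act s (g (f i) j) ∈ act s (f i)).
    { apply act_mem, Hg. now exists j. }
    rewrite Hi' in H. apply Hg in H as [j' Hj'].
    now exists (existT _ i' j').
  - exists u. intros x. rewrite (Hu x). split.
    + intros [[i j] ->]. simpl. exists (f i). split; [apply Hf | apply Hg]; eauto.
    + intros (y & [i ->]%Hf & [j ->]%Hg). now exists (existT _ i j).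
Qed.

(** The subsets of [a] that belong to the model are indexed by the predicates on
    the index type of [a] that are realised in the model, and this type is
    again small. *)
Lemma PM_power (a : PM) : exists p, Power p a.
Proof.
  destruct (supported_exists a) as [n Hn].
  destruct (PM_elements a) as (X & f & Hf).
  set (codes (P : X -> Prop) b := forall z, z ∈ b <-> exists i, P i /\ z = f i).
  destruct (choice (fun (P : {P | exists b, codes P b}) b => codes (proj1_sig P) b))
    as [g Hg].
  { intros [P HP]. exact HP. }
  assert (Hcode : forall b, Subset b a <-> exists P, b = g P).
  { intros b. split.
    - intros Hb.
      assert (HP : codes (fun i => f i ∈ b) b).
      { intros z. split.
        - intros Hz. destruct (proj1 (Hf z) (Hb z Hz)) as [i ->]. eauto.
        - now intros (i & Hi & ->). }
      set (P := exist (fun P => exists b, codes P b) _ (ex_intro _ b HP)).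
      exists P. apply PM_extensionality. intros z.
      rewrite (HP z). symmetry. exact (Hg P z).
    - intros [P ->] z (i & _ & ->)%Hg. apply Hf. now exists i. }
  destruct (collect _ g n) as [p Hp].
  - intros s P Hs. apply Hcode. intros z Hz.
    rewrite <- (act_inverse s z), act_mem in Hz.
    rewrite <- (act_inverse s z). apply (supported_mem n); [assumption..|].
    apply (proj2 (Hcode (g P))); [now exists P | assumption].
  - exists p. intros b. now rewrite (Hp b), Hcode.
Qed.

Lemma PM_succ (a : PM) : exists s, Succ s a.
Proof.
  destruct (PM_pair a a) as [p Hp], (PM_pair a p) as [q Hq],
    (PM_union q) as [u Hu].
  exists u. intros x. rewrite (Hu x). split.
  - intros (y & [->| ->]%Hq & Hx); [auto|]. apply Hp in Hx. tauto.
  - intros [Hx| ->]; [exists a | exists p]; (split; [apply Hq; auto|]);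
      [assumption | apply Hp; auto].
Qed.

Fixpoint numeral (k : nat) : PM :=
  match k with
  | 0 => proj1_sig (constructive_indefinite_description _ PM_empty)
  | S k => proj1_sig (constructive_indefinite_description _ (PM_succ (numeral k)))
  end.

Lemma numeral_0 : Empty (numeral 0).
Proof. apply (proj2_sig (constructive_indefinite_description _ PM_empty)). Qed.

Lemma numeral_S k : Succ (numeral (S k)) (numeral k).
Proof.
  apply (proj2_sig (constructive_indefinite_description _ (PM_succ (numeral k)))).
Qed.

Lemma act_numeral s k : act s (numeral k) = numeral k.
Proof.
  induction k as [|k IH]; apply PM_extensionality; intros z;
    rewrite <- (act_inverse s z); set (y := act (opp s) z); rewrite act_mem.
  - split; intros H; exfalso; exact (numeral_0 _ H).
  - rewrite (numeral_S k y), (numeral_S k (act s y)).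
    rewrite <- IH at 3 4. rewrite act_mem. split; (intros [H|H]; [now left|right]).
    + now rewrite H.
    + exact (act_injective s _ _ H).
Qed.

Lemma PM_inductive : exists w : PM, Inductive_set w /\
  forall z, z ∈ w <-> exists k, z = numeral k.
Proof.
  destruct (collect nat numeral 0) as [w Hw].
  { intros s k _. exists k. apply act_numeral. }
  exists w. split; [split|assumption].
  - exists (numeral 0). split; [apply numeral_0|]. apply Hw. now exists 0.
  - intros x [k ->]%Hw. exists (numeral (S k)). split; [apply numeral_S|].
    apply Hw. now exists (S k).
Qed.

(** The finitely many parameters that occur in the formula have a common
    support. *)
Lemma PM_comprehension n A : bounded (S n) A -> holds PM (ax_comprehension n A).
Proof.
  intros HA. unfold ax_comprehension. rewrite holds_iter_all. intros e a.
  assert (exists N, forall i, i < n -> supported N (e i)) as [N HN].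
  { clear HA. induction n as [|n [N HN]]; [exists 0; lia|].
    destruct (supported_exists (e n)) as [m Hm]. exists (max m N).
    intros i Hi. destruct (Nat.eq_dec i n) as [->|].
    - eapply supported_mono; [|exact Hm]. lia.
    - eapply supported_mono; [|apply HN]; lia. }
  refine (proj2 (_ : _ <-> exists b, forall x : PM,
    x ∈ b <-> x ∈ a /\ sat PM (scons x e) A) _).
  { apply sat_ex. intros b. apply sat_all. intros x.
    apply sat_iff; [reflexivity|]. apply sat_and; [reflexivity|].
    rewrite sat_rename. apply sat_ext. now intros [|i]. }
  apply symmetric_separation with N. intros s x Hs Hx.
  apply (act_sat s) in Hx. revert Hx. apply sat_bounded with (S n); [assumption|].
  intros [|i] Hi; simpl; [reflexivity|].
  symmetry. apply HN; [lia | assumption].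
Qed.

Lemma PM_model : model PM theory_Z.
Proof.
  intros A []; [..|now apply PM_comprehension]; intros e.
  - refine (proj2 (_ : _ <-> forall a b : PM, (forall z, z ∈ b <-> z ∈ a) -> b = a) _);
      [unfold ax_extensionality; decode|].
    intros a b. apply PM_extensionality.
  - refine (proj2 (_ : _ <-> exists a : PM, Empty a) PM_empty).
    unfold ax_null; decode.
  - refine (proj2 (_ : _ <-> forall a b : PM, exists p, Pair p b a) _);
      [unfold ax_pair; decode|]. intros a b. apply PM_pair.
  - refine (proj2 (_ : _ <-> forall a : PM, exists p, Union p a) PM_union).
    unfold ax_union; decode.
  - refine (proj2 (_ : _ <-> exists w : PM, Inductive_set w) _);
      [unfold ax_infinity; decode|].
    destruct PM_inductive as (w & Hw & _). now exists w.
  - refine (proj2 (_ : _ <-> forall a : PM, exists p, Power p a) PM_power).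
    unfold ax_power; decode.
Qed.

Lemma PM_omega : exists w : PM, Omega w /\
  forall z, z ∈ w <-> exists k, z = numeral k.
Proof.
  destruct PM_inductive as (w & Hind & Hw). exists w. split; [|assumption].
  split; [assumption|]. intros v [[o [Ho Hov]] HS] z [k ->]%Hw.
  induction k as [|k IH].
  - replace (numeral 0) with o; [assumption|]. apply PM_extensionality.
    intros z. split; intros H; exfalso; [exact (Ho z H) | exact (numeral_0 z H)].
  - destruct (HS _ IH) as (t & Ht & Htv). replace (numeral (S k)) with t;
      [assumption|]. apply PM_extensionality. intros z.
    now rewrite (Ht z), (numeral_S k z).
Qed.

(** A number of the model is not an element of itself, so a smaller numeral, being
    an element of a larger one, differs from it. *)
Lemma numeral_injective j k : numeral j = numeral k -> j = k.
Proof.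
  destruct PM_omega as (w & Hw & Hnum).
  assert (Hlt : forall j k, j < k -> numeral j <> numeral k).
  { intros i l Hil E.
    assert (H : numeral i ∈ numeral l).
    { clear E. induction Hil as [|l Hil IH]; apply numeral_S; auto. }
    rewrite E in H. revert H. apply (number_irreflexive PM_model w Hw).
    apply Hnum. now exists l. }
  intros E. destruct (Nat.lt_trichotomy j k) as [H|[H|H]]; [|assumption|];
    [now elim (Hlt j k H) | now elim (Hlt k j H)].
Qed.

(** * Countable choice fails *)

Lemma act_related s (r a b : PM) :
  Related (act s r) (act s a) (act s b) <-> Related r a b.
Proof.
  assert (H : forall r a b : PM,
    sat PM (scons r (scons a (fun _ => b))) (related 0 1 2) <-> Related r a b).
  { intros. decode. }
  rewrite <- !H, <- (act_sat s _ (scons r (scons a (fun _ => b)))).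
  apply sat_ext. now intros [|[|i]].
Qed.

Lemma act_opair s (p a b : PM) :
  OPair (act s p) (act s a) (act s b) <-> OPair p a b.
Proof.
  assert (H : forall r a b : PM,
    sat PM (scons r (scons a (fun _ => b))) (is_opair 0 1 2) <-> OPair r a b).
  { intros. decode. }
  rewrite <- !H, <- (act_sat s _ (scons p (scons a (fun _ => b)))).
  apply sat_ext. now intros [|[|i]].
Qed.

Lemma symmetric_relation (P : PM -> PM -> Prop) n :
  (forall s x y, vanishes n s -> P x y -> P (act s x) (act s y)) ->
  forall a b, exists r,
  Relation r a b /\ forall x y, Related r x y <-> x ∈ a /\ y ∈ b /\ P x y.
Proof.
  intros HP a b. destruct (opairs_bounded PM_model a b) as [c Hc].
  destruct (supported_exists a) as [k Hk], (supported_exists b) as [l Hl].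
  destruct (symmetric_separation (fun p =>
    exists x y, x ∈ a /\ y ∈ b /\ P x y /\ OPair p x y) (k + l + n)) with c as [r Hr].
  { intros s p Hs (x & y & Hx & Hy & Hxy & Hp).
    assert (Hsk : vanishes k s) by (apply (vanishes_mono _ (k + l + n)); [lia | assumption]).
    assert (Hsl : vanishes l s) by (apply (vanishes_mono _ (k + l + n)); [lia | assumption]).
    assert (Hsn : vanishes n s) by (apply (vanishes_mono _ (k + l + n)); [lia | assumption]).
    exists (act s x), (act s y). rewrite act_opair.
    split; [now apply (supported_mem k)|]. split; [now apply (supported_mem l)|]. auto. }
  exists r. apply (related_graph PM_model). intros p. rewrite (Hr p).
  split; [tauto|]. intros H. split; [|assumption].
  destruct H as (x & y & Hx & Hy & _ & Hp). now apply (Hc x y p).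
Qed.

(** The family is given by the relation between each number [k] and all atoms of
    level [k].  Translating level [m] alone fixes any function supported by [m]
    but no atom of level [m]. *)
Lemma PM_not_choice : ~ @Countable_choice PM.
Proof.
  intros HAC. destruct PM_omega as (w & Hw & Hnum).
  destruct (collect (nat * Qc) (fun i => set_atom (fst i) (snd i)) 0) as [b Hb].
  { intros s [k q] _. exists (k, (q + s k)%Qc). apply act_atom. }
  destruct (symmetric_relation (fun x y =>
      exists k q, x = numeral k /\ y = set_atom k q) 0) with w b as (r & Hr & Hrel).
  { intros s x y _ (k & q & -> & ->). exists k, (q + s k)%Qc.
    now rewrite act_numeral, act_atom. }
  destruct (HAC w b r Hw Hr) as (f & [_ Hfun] & Hf).
  { intros n Hn. assert (Hn' := Hn). apply Hnum in Hn' as [k ->].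
    exists (set_atom k 0%Qc).
    assert (set_atom k 0%Qc ∈ b) by (apply Hb; now exists (k, 0%Qc)).
    split; [assumption|]. apply Hrel. eauto 6. }
  destruct (supported_exists f) as [m Hm].
  assert (Hmw : numeral m ∈ w) by (apply Hnum; now exists m).
  destruct (Hf (numeral m) Hmw)
    as (y & Hy & (_ & _ & k & q & E%numeral_injective & ->)%Hrel).
  subst k.
  set (s := fun j => if Nat.eq_dec j m then 1%Qc else 0%Qc).
  assert (Hs : vanishes m s).
  { intros j Hj. unfold s. destruct (Nat.eq_dec j m); [lia | reflexivity]. }
  assert (Hy' := Hy). apply (act_related s) in Hy'.
  rewrite Hm, act_numeral, act_atom in Hy' by assumption.
  destruct (Hfun (numeral m) Hmw) as (z & _ & Hz).
  assert (E : set_atom m (q + s m)%Qc = set_atom m q).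
  { now rewrite (Hz _ Hy), (Hz _ Hy'). }
  apply set_atom_inj in E as [_ E]. unfold s in E.
  destruct (Nat.eq_dec m m) as [_|]; [|contradiction].
  assert (H : (1 = 0)%Qc) by (rewrite <- (Qcplus_opp_r q), <- E at 1; ring).
  discriminate H.
Qed.

(** * Infinite orbits and Dedekind infinity *)

Fixpoint qnat (k : nat) : Qc :=
  match k with 0 => 0%Qc | S k => (1 + qnat k)%Qc end.

Lemma qnat_add j k : qnat (j + k) = (qnat j + qnat k)%Qc.
Proof. induction j as [|j IH]; simpl; [|rewrite IH]; ring. Qed.

Lemma qnat_mul j k : qnat (j * k) = (qnat j * qnat k)%Qc.
Proof. induction j as [|j IH]; simpl; [|rewrite qnat_add, IH]; ring. Qed.

Lemma qnat_nonzero k : k <> 0 -> qnat k <> 0%Qc.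
Proof.
  assert (Hpos : forall k, (0 <= qnat k)%Qc).
  { clear. intros k. induction k as [|k IH]; [discriminate|].
    change 0%Qc with (0 + 0)%Qc. simpl. apply Qcplus_le_compat; [discriminate | assumption]. }
  destruct k as [|k]; [contradiction|]. intros _ H. simpl in H.
  assert (H1 := Qcplus_le_compat 1 1 0 (qnat k) (Qcle_refl 1) (Hpos k)).
  rewrite H in H1. now apply H1.
Qed.

Definition scale (q : Qc) (s : translation) : translation :=
  fun j => (q * s j)%Qc.

Lemma act_scale_iter x s k : act s x = x -> act (scale (qnat k) s) x = x.
Proof.
  intros H. induction k as [|k IH].
  - replace (scale (qnat 0) s) with zero; [apply act_zero|].
    apply functional_extensionality. intros j. unfold scale, zero. simpl. ring.
  - replace (scale (qnat (S k)) s) with (add s (scale (qnat k) s)).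
    + now rewrite <- act_add, IH.
    + apply functional_extensionality. intros j. unfold scale, add. simpl. ring.
Qed.

Lemma divide_fact d n : 0 < d <= n -> exists k, fact n = k * d.
Proof.
  induction n as [|n IH]; intros Hd; [lia|].
  destruct (Nat.eq_dec d (S n)) as [->|].
  - exists (fact n). simpl. lia.
  - destruct IH as [k Hk]; [lia|]. exists (S n * k).
    change (fact (S n)) with (S n * fact n). rewrite Hk. lia.
Qed.

(** Let [N] be the length of the list and let [s] move [x].  If the orbit were
    contained in the list, two of the [N + 1] translates of [x] by multiples
    [i / N!] of [s], for [i] at most [N], would coincide, so that
    [(d / N!) s] would fix [x] for some positive [d] at most [N].  As [d] divides
    [N!], a multiple of this translation is [s] itself, which would fix [x]. *)
Lemma orbit_infinite n x : ~ supported n x ->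
  forall l : list PM, exists s, vanishes n s /\ ~ In (act s x) l.
Proof.
  intros Hx l. apply NNPP. intros Hno. apply Hx. intros s Hs.
  assert (Hin : forall q, In (act (scale q s) x) l).
  { intros q. apply NNPP. intros Hq. apply Hno. exists (scale q s).
    split; [|assumption]. intros j Hj. unfold scale. rewrite Hs by assumption. ring. }
  set (c := (/ qnat (fact (length l)))%Qc).
  set (y i := act (scale (qnat i * c)%Qc s) x).
  assert (exists i j, i < j <= length l /\ y i = y j) as (i & j & Hij & E).
  { apply NNPP. intros Hinj.
    assert (Hnd : NoDup (map y (seq 0 (S (length l))))).
    { apply NoDup_map_NoDup_ForallPairs; [|apply seq_NoDup].
      intros i j Hi%in_seq Hj%in_seq E.
      destruct (Nat.lt_trichotomy i j) as [H|[H|H]]; [|assumption|]; elim Hinj.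
      - exists i, j. split; [lia | assumption].
      - exists j, i. split; [lia | now symmetry]. }
    assert (Hle := NoDup_incl_length Hnd (l' := l)).
    rewrite length_map, length_seq in Hle. assert (S (length l) <= length l); [|lia].
    apply Hle. intros z (i & <- & _)%in_map_iff. apply Hin. }
  destruct (divide_fact (j - i) (length l)) as [k Hk]; [lia|].
  assert (Hd : act (scale (qnat (j - i) * c)%Qc s) x = x).
  { apply (act_injective (scale (qnat i * c)%Qc s)). rewrite act_add.
    fold (y i). rewrite E. unfold y. f_equal.
    apply functional_extensionality. intros m. unfold add, scale.
    replace j with (i + (j - i)) at 2 by lia. rewrite qnat_add. ring. }
  apply (act_scale_iter x _ k) in Hd. rewrite <- Hd at 2. f_equal.
  apply functional_extensionality. intros m. unfold scale.
  transitivity (qnat (k * (j - i)) * c * s m)%Qc; [|rewrite qnat_mul; ring].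
  rewrite <- Hk. unfold c. rewrite Qcmult_inv_r; [ring|].
  apply qnat_nonzero, fact_neq_0.
Qed.

Lemma injective_sequence {T : Type} (P : T -> Prop) :
  (forall l, exists x, P x /\ ~ In x l) ->
  exists g : nat -> T, (forall i, P (g i)) /\ forall i j, g i = g j -> i = j.
Proof.
  intros H. apply choice in H as [F HF].
  set (prefix := fix prefix k :=
    match k with 0 => [] | S k => F (prefix k) :: prefix k end).
  exists (fun k => F (prefix k)). split; [intros i; apply HF|].
  assert (Hlt : forall i j, i < j -> F (prefix i) <> F (prefix j)).
  { intros i j Hij E. apply (proj2 (HF (prefix j))). rewrite <- E. clear E.
    induction Hij; simpl; auto. }
  intros i j E. destruct (Nat.lt_trichotomy i j) as [L|[L|L]]; [|assumption|];
    [now elim (Hlt i j L) | now elim (Hlt j i L)].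
Qed.

(** A support [m] is shared by infinitely many members of [X]: the support of [X] if
    it supports all members, otherwise the support of a member whose orbit is
    infinite.  The shift along a sequence of such members is supported by [m]. *)
Lemma PM_SD (X : PM) : ~ Finite X -> Dedekind_infinite X.
Proof.
  intros HX. destruct (supported_exists X) as [n Hn].
  assert (exists m, forall l, exists x, (x ∈ X /\ supported m x) /\ ~ In x l)
    as [m Hm].
  { destruct (classic (forall x, x ∈ X -> supported n x)) as [Hall|Hnot].
    - exists n. intros l. apply NNPP. intros Hno. apply HX.
      apply (finite_of_list PM_model l). intros x Hx. apply NNPP. intros Hl.
      apply Hno. exists x. auto.
    - assert (exists x, x ∈ X /\ ~ supported n x) as (x & Hx & Hsx).
      { apply NNPP. intros Hno. apply Hnot. intros x Hx. apply NNPP. eauto. }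
      destruct (supported_exists x) as [m Hm]. exists m. intros l.
      destruct (orbit_infinite n x Hsx l) as (s & Hs & Hl).
      exists (act s x). split; [|assumption].
      split; [now apply (supported_mem n) | now apply supported_act]. }
  destruct (injective_sequence _ Hm) as (g & Hg & Hinj).
  destruct (symmetric_relation (fun x y =>
      (exists i, x = g i /\ y = g (S i)) \/ (forall i, x <> g i) /\ x = y) m)
    with X X as (r & _ & Hr).
  { intros s x y Hs [(i & -> & ->)|[Hno ->]].
    - left. exists i. split; apply Hg, Hs.
    - right. split; [|reflexivity]. intros i E. apply (Hno i).
      apply (act_injective s). rewrite E. symmetry. apply Hg, Hs. }
  apply (injection_dedekind_infinite PM_model X r (g 0)).
  - intros x Hx. destruct (classic (exists i, x = g i)) as [[i ->]|Hno].
    + exists (g (S i)). assert (g (S i) ∈ X) by apply Hg.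
      split; [assumption|]. apply Hr. eauto 6.
    + exists x. split; [assumption|]. apply Hr. repeat split; try assumption.
      right. split; [|reflexivity]. intros i E. eauto.
  - intros x y y' (_ & _ & H)%Hr (_ & _ & H')%Hr.
    destruct H as [(i & E & ->)|[Hno E]], H' as [(j & E' & ->)|[Hno' E']].
    + do 2 f_equal. apply Hinj. congruence.
    + now elim (Hno' i).
    + now elim (Hno j).
    + congruence.
  - intros x x' y (_ & _ & H)%Hr (_ & _ & H')%Hr.
    destruct H as [(i & -> & E)|[Hno E]], H' as [(j & -> & E')|[Hno' E']].
    + f_equal. assert (S i = S j) by (apply Hinj; congruence). lia.
    + elim (Hno' (S i)). congruence.
    + elim (Hno (S j)). congruence.
    + congruence.
  - apply Hg.
  - intros x _ (_ & _ & [(i & _ & E)|[Hno ->]])%Hr.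
    + now apply Hinj in E.
    + now elim (Hno 0).
Qed.

Theorem theorem3p8 :
  consistent theory_Z ->
  provable (extend theory_Z AC_aleph0) SD /\
  exists M : structure, model M theory_Z /\ holds M SD /\ ~ holds M AC_aleph0.
Proof.
  intros _. split; [exact Z_choice_proves_SD|]. exists PM.
  split; [exact PM_model|]. split.
  - apply holds_SD, PM_SD.
  - rewrite holds_AC. exact PM_not_choice.
Qed.
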